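(* Let $\phi_0\in\mathbb{R}$ and $\alpha_0>0$. Let $\{\eta_t\}_{t\ge 1}$ be a sequence of i.i.d. symmetric random variables such that $\sigma_{\gamma_0}^2:=\mathrm{var}\big(\log|\phi_0+\eta_t\sqrt{\alpha_0}|\big)\in(0,\infty)$, and put $\gamma_0:=E\log|\phi_0+\eta_t\sqrt{\alpha_0}|$. Let $y_0$ be a symmetric random variable with $P(y_0=0)=0$, independent of $\{\eta_t:t\ge 1\}$, and define $$y_t=\phi_0 y_{t-1}+\eta_t\sqrt{\alpha_0 y_{t-1}^2},\qquad t\ge 1.$$ For $n\ge 1$ let $$\widehat{\gamma}_n=\frac{1}{n}\big(\log|y_n|-\log|y_0|\big).$$ Then: (i) $\widehat{\gamma}_n$ is an unbiased estimator of $\gamma_0$, i.e. $E\widehat{\gamma}_n=\gamma_0$; (ii) $\widehat{\gamma}_n\to\gamma_0$ almost surely as $n\to\infty$; (iii) $\sqrt{n}(\widehat{\gamma}_n-\gamma_0)\Longrightarrow N(0,\sigma_{\gamma_0}^2)$ as $n\to\infty$.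
   Context: ''$\Longrightarrow$'' denotes weak convergence (convergence in distribution). A random variable $X$ is symmetric if $X$ and $-X$ have the same distribution. The $\eta_t$ are not required to have mean zero or variance one. *)

(* Defs.v *)
From HB Require Import structures.
From mathcomp Require Import all_boot all_order all_algebra.
From mathcomp Require Import finmap.
From mathcomp Require Import all_classical all_reals all_analysis.

Set Implicit Arguments.
Unset Strict Implicit.
Unset Printing Implicit Defensive.

Import Order.TTheory GRing.Theory Num.Theory.
Import numFieldNormedType.Exports.

Local Open Scope classical_set_scope.
Local Open Scope ring_scope.

Section probability_notions.
Context {d : measure_display} {T : measurableType d} {R : realType}.
Variable P : probability T R.

(* Laws are compared on Borel sets only: [distribution P X] is a total function
   on sets whose values on nonmeasurable sets carry no meaning. *)
Definition same_law (X Y : {RV P >-> R}) : Prop :=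
  forall A : set R, measurable A -> distribution P X A = distribution P Y A.

Definition symmetric_RV (X : {RV P >-> R}) : Prop :=
  forall A : set R, measurable A ->
    P [set w | A (X w)] = P [set w | A (- X w)].

Definition independent_RVs (I : set nat) (X : nat -> {RV P >-> R}) : Prop :=
  forall (J : {fset nat}) (A : nat -> set R),
    [set` J] `<=` I -> (forall i, i \in J -> measurable (A i)) ->
    P (\bigcap_(i in [set` J]) (X i @^-1` A i)) =
    (\prod_(i <- J) P (X i @^-1` A i))%E.

Definition iid (I : set nat) (X : nat -> {RV P >-> R}) : Prop :=
  independent_RVs I X /\ (forall i j, I i -> I j -> same_law (X i) (X j)).

Definition sigma_RVs (I : set nat) (X : nat -> {RV P >-> R}) : set (set T) :=
  <<s \bigcup_(i in I) preimage_set_system setT (X i) measurable >>.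

Definition independent_of_family (Y : {RV P >-> R}) (I : set nat)
    (X : nat -> {RV P >-> R}) : Prop :=
  forall (A : set R) (B : set T), measurable A -> sigma_RVs I X B ->
    P (Y @^-1` A `&` B) = (P (Y @^-1` A) * P B)%E.

(* The laws of the [X n] converge weakly to [mu]: convergence of the integrals
   of all bounded continuous functions. *)
Definition cvg_in_distribution (X : nat -> T -> R)
    (mu : probability (measurableTypeR R) R) : Prop :=
  forall f : R -> R, continuous f -> (exists M : R, forall x, `|f x| <= M) ->
    'E_P[f \o X n]%E @[n --> \oo] --> (\int[mu]_x (f x)%:E)%E.

End probability_notions.

Section model.
Context {d : measure_display} {T : measurableType d} {R : realType}.

Definition log_coef (phi0 alpha0 : R) (eta : T -> R) (w : T) : R :=
  ln `|phi0 + eta w * Num.sqrt alpha0|.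

Definition gamma_hat (y : nat -> T -> R) (n : nat) (w : T) : R :=
  n%:R^-1 * (ln `|y n w| - ln `|y 0%N w|).

End model.

(* Main.v *)
Require Import Defs.
From HB Require Import structures.
From mathcomp Require Import all_boot all_order all_algebra.
From mathcomp Require Import finmap zify ring lra.
From mathcomp Require Import all_classical all_reals all_analysis.
From mathcomp Require Import measurable_realfun.

(** The recursion reads [y_t = y_(t-1) (phi0 + s_(t-1) eta_t sqrt alpha0)], where
    [s_(t-1)] is the sign of [y_(t-1)].  This sign depends only on [y_0] and on
    [eta_1], ..., [eta_(t-1)], and [eta_t] is symmetric and independent of
    them; hence [s_(t-1) eta_t] is again independent of that past and has the
    law of [eta_t] ([signed_noise_indep]).  The factor is almost surely nonzero,
    so that one may take logarithms: almost surely, [log |y_n| - log |y_0|] is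
    the sum of [n] variables [gamma0 + Z_i], where [Z_i] is independent of the
    past up to [i] and has a fixed centred law of variance [sigma2]
    ([gamma_hat_psum]).  The three claims are then the three classical facts on
    such sums.

    - Unbiasedness is linearity of the expectation.

    - The strong law holds in its second moment form ([slln_psum]): the [Z_i]
      are orthogonal, the expected squares of the normalized sums along the
      perfect squares, with all fluctuations between two consecutive squares
      included, form a convergent series, and therefore the terms tend to zero
      almost surely.

    - The central limit theorem ([clt_psum]) is proved by Lindeberg's method in
      the operator form due to Trotter.  A law [mu] acts on test functions by
      [conv mu c g x = E g(x + c Z)], and [E g(c (Z_1 + ... + Z_n))] is the value
      at 0 of the [n]-th iterate ([psum_iter_conv]).  Two laws with mean zero and
      the same variance act alike up to a Taylor remainder, and exchanging them
      in the [n] factors one at a time costs [n] remainders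
      ([lindeberg_exchange]), which tend to zero for [c = 1 / sqrt n]
      ([cvg_taylor_rest]).  For the normal law the iterate is known exactly,
      since normal laws are stable under convolution ([iter_conv_normal]); its
      variance is obtained from its moment generating function
      ([gaussian_variance]).

    The test functions of this argument have to be smooth.  It is applied to the
    translates and dilates of one piecewise cubic step; their increments form
    partitions of unity made of B-splines, which approximate a continuous
    function uniformly on segments ([spline_approx]), and the bounded second
    moments take care of the tails ([weak_cvg_of_steps]). *)

Set Implicit Arguments.
Unset Strict Implicit.
Unset Printing Implicit Defensive.

Import Order.TTheory GRing.Theory Num.Theory.
Import numFieldNormedType.Exports.

Local Open Scope classical_set_scope.
Local Open Scope ring_scope.

(** * Averages of translates of a bounded function *)

Section bounded_measurable.
Context {d : measure_display} {T : measurableType d} {R : realType}.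
Implicit Types (f g : T -> R).

Definition bounded_by (M : R) f := forall x, `|f x| <= M.

Definition bmeas f := measurable_fun setT f /\ exists M, bounded_by M f.

Lemma bmeas_integrable (P : probability T R) f :
  bmeas f -> P.-integrable setT (EFin \o f).
Proof.
move=> [mf [M fM]]; apply: measurable_bounded_integrable => //.
  by rewrite (le_lt_trans (probability_le1 P measurableT)) ?ltry.
exists M; split; first by rewrite num_real.
by move=> N MN x _; exact: le_trans (fM x) (ltW MN).
Qed.

Lemma bmeasB f g : bmeas f -> bmeas g -> bmeas (fun x => f x - g x).
Proof.
move=> [mf [M fM]] [mg [M' gM']]; split; first exact: measurable_funB.
by exists (M + M') => x; rewrite (le_trans (ler_normB _ _))// lerD.
Qed.

Lemma bmeasD f g : bmeas f -> bmeas g -> bmeas (fun x => f x + g x).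
Proof.
move=> [mf [M fM]] [mg [M' gM']]; split; first exact: measurable_funD.
by exists (M + M') => x; rewrite (le_trans (ler_normD _ _))// lerD.
Qed.

Lemma bmeasZ (k : R) f : bmeas f -> bmeas (fun x => k * f x).
Proof.
move=> [mf [M fM]]; split; first exact: measurable_funM.
by exists (`|k| * M) => x; rewrite normrM ler_wpM2l.
Qed.

Lemma Rintegral_prob_cst (P : probability T R) (r : R) : \int[P]_x r = r.
Proof. by rewrite Rintegral_cst// [X in fine X](probability_setT P) mulr1. Qed.

Lemma bounded_Rintegral (P : probability T R) M f :
  measurable_fun setT f -> bounded_by M f -> `|\int[P]_x f x| <= M.
Proof.
move=> mf fM; have If : bmeas f by split => //; exists M.
rewrite (le_trans (le_normr_Rintegral _ _))//; first exact: bmeas_integrable.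
rewrite -[leRHS](Rintegral_prob_cst P); apply: le_Rintegral => //.
- exact/integrable_norm/bmeas_integrable.
- exact: finite_measure_integrable_cst.
Qed.

End bounded_measurable.

Section conv.
Context {R : realType}.
Implicit Types (mu nu : probability R R) (g : R -> R) (c : R).

(** The law of a summand as an operator on test functions.  Its iterates yield
    expectations at sums of independent variables without any need for a
    probability space that carries these variables; in particular no normal
    variables have to be constructed next to the given ones. *)
Definition conv mu c g x := \int[mu]_z g (x + c * z).

Lemma measurable_fun_shift g c x : measurable_fun setT g ->
  measurable_fun setT (fun z => g (x + c * z)).
Proof.
move=> mg; apply: (measurableT_comp mg).
by apply: measurable_funD => //; exact: measurable_funM.
Qed.

Lemma bmeas_shift g c x : bmeas g -> bmeas (fun z => g (x + c * z)).
Proof.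
move=> [mg [M gM]]; split; first exact: measurable_fun_shift.
by exists M => z; exact: gM.
Qed.

Lemma bmeas_shift2 g c : bmeas g -> bmeas (fun p : R * R => g (p.1 + c * p.2)).
Proof.
move=> [mg [M gM]]; split; last by exists M => z; exact: gM.
apply: (measurableT_comp mg).
by apply: measurable_funD => //; apply: measurable_funM.
Qed.

Lemma conv_bounded mu c g M : measurable_fun setT g -> bounded_by M g ->
  bounded_by M (conv mu c g).
Proof.
move=> mg gM x; apply: bounded_Rintegral; first exact: measurable_fun_shift.
by move=> z; exact: gM.
Qed.

Lemma bmeas_conv mu c g : bmeas g -> bmeas (conv mu c g).
Proof.
move=> bg; split; last first.
  by case: bg => mg [M gM]; exists M; exact: conv_bounded.
have /bmeas_integrable := bmeas_shift2 c bg.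
move=> /(_ (mu \x mu)%E) /measurable_fubini_F mF.
by apply: measurableT_comp; last exact: mF.
Qed.

Lemma conv_dist mu c g h e : bmeas g -> bmeas h ->
  (forall x, `|g x - h x| <= e) ->
  forall x, `|conv mu c g x - conv mu c h x| <= e.
Proof.
move=> bg bh ghe x; rewrite -RintegralB//; try exact/bmeas_integrable/bmeas_shift.
apply: (@bounded_Rintegral _ _ _ mu e (fun z => g (x + c * z) - h (x + c * z))).
  by apply: measurable_funB; apply: measurable_fun_shift; [case: bg|case: bh].
by move=> z; exact: ghe.
Qed.

(** A function with two formal derivatives and a Taylor remainder that is
    uniform in the base point.  No actual derivative is asked for: all that
    matters is the inequality, and it is inherited by every average of
    translates of [g]. *)
Definition taylor2 (K : R) g g1 g2 :=
  [/\ bmeas g, bmeas g1, bmeas g2 & forall x h,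
     `|g (x + h) - g x - g1 x * h - g2 x * (h ^+ 2 / 2)|
       <= K * Num.min (h ^+ 2) (`|h| ^+ 3)].

Lemma conv_taylor2 mu c K g g1 g2 : taylor2 K g g1 g2 ->
  taylor2 K (conv mu c g) (conv mu c g1) (conv mu c g2).
Proof.
move=> [bg bg1 bg2 tg]; split; try exact: bmeas_conv.
move=> x h; rewrite /conv.
have I f y : bmeas f -> mu.-integrable setT (EFin \o (fun z => f (y + c * z))).
  by move=> bf; exact/bmeas_integrable/bmeas_shift.
have Z f y k : bmeas f ->
    mu.-integrable setT (EFin \o (fun z => f (y + c * z) * k)).
  move=> [mf [M fM]]; apply: bmeas_integrable; split.
    by apply: measurable_funM => //; exact: measurable_fun_shift.
  by exists (M * `|k|) => z; rewrite normrM ler_wpM2r.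
have B (f1 f2 : R -> R) : mu.-integrable setT (EFin \o f1) ->
    mu.-integrable setT (EFin \o f2) ->
    mu.-integrable setT (EFin \o (fun z => f1 z - f2 z)).
  by move=> i1 i2; exact: (integrableB measurableT i1 i2).
rewrite -!RintegralZr//; try exact: I.
rewrite -RintegralB//; try exact: I.
rewrite -RintegralB//; try by [exact: Z | apply: B; exact: I].
rewrite -RintegralB//; try exact: Z; last first.
  apply: (B (fun z => g (x + h + c * z) - g (x + c * z))); last exact: Z.
  by apply: B; exact: I.
apply: bounded_Rintegral => [|z].
  apply: measurable_funB.
    apply: measurable_funB.
      apply: measurable_funB; apply: measurable_fun_shift; by case: bg.
    by apply: measurable_funM => //; apply: measurable_fun_shift; case: bg1.
  by apply: measurable_funM => //; apply: measurable_fun_shift; case: bg2.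
by rewrite (addrAC x h); exact: tg.
Qed.

End conv.

(** * Trotter's form of Lindeberg's comparison *)

Section lindeberg.
Context {R : realType}.
Implicit Types (mu nu : probability R R) (g : R -> R) (c : R).

Definition centered_var mu (v : R) :=
  [/\ mu.-integrable setT (EFin \o (fun z => z)), \int[mu]_z z = 0,
      mu.-integrable setT (EFin \o (fun z => z ^+ 2)) &
      \int[mu]_z (z ^+ 2) = v].

(** Both powers matter: the square is integrable under a second moment alone,
    the cube makes the whole negligible with respect to [c ^+ 2]. *)
Definition taylor_rest mu c := \int[mu]_z Num.min ((c * z) ^+ 2) (`|c * z| ^+ 3).

Lemma measurable_taylor_rest c :
  measurable_fun [set: R] (fun z => Num.min ((c * z) ^+ 2) (`|c * z| ^+ 3)).
Proof.
apply: measurable_minr; apply: measurable_funX; first exact: measurable_funM.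
by apply: measurableT_comp => //; exact: measurable_funM.
Qed.

Lemma integrable_taylor_rest mu c v : centered_var mu v ->
  mu.-integrable setT
    (EFin \o (fun z => Num.min ((c * z) ^+ 2) (`|c * z| ^+ 3))).
Proof.
move=> [_ _ i2 _].
apply: (@le_integrable _ _ _ mu setT measurableT _
    (EFin \o (fun z => c ^+ 2 * z ^+ 2))).
- by apply/measurable_EFinP; exact: measurable_taylor_rest.
- move=> z _ /=; rewrite lee_fin -exprMn (ger0_norm (sqr_ge0 _)) ger0_norm.
  + by rewrite ge_min lexx.
  + by rewrite le_min sqr_ge0 exprn_ge0.
- exact: (integrableZl measurableT (c ^+ 2) i2).
Qed.

(** The first two moments of [mu] account for the first three terms of the
    Taylor expansion of [conv mu c g], so that laws with equal variance act
    alike up to [taylor_rest]. *)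
Lemma conv_expansion mu c K g g1 g2 v x : 0 <= K -> taylor2 K g g1 g2 ->
  centered_var mu v ->
  `|conv mu c g x - (g x + g2 x * (c ^+ 2 * v / 2))| <= K * taylor_rest mu c.
Proof.
move=> K0 [bg bg1 bg2 tg] cv; have [i1 m1 i2 m2] := cv.
have Ig : mu.-integrable setT (EFin \o (fun z => g (x + c * z))).
  exact/bmeas_integrable/bmeas_shift.
have Ip : mu.-integrable setT
    (EFin \o (fun z => g x + (g1 x * c) * z + (g2 x * c ^+ 2 / 2) * z ^+ 2)).
  have I0 := finite_measure_integrable_cst mu (g x) (@measurableT _ R).
  have I1 := integrableZl measurableT (g1 x * c) i1.
  have I2 := integrableZl measurableT (g2 x * c ^+ 2 / 2) i2.
  exact: (integrableD measurableT (integrableD measurableT I0 I1) I2).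
have Ep : \int[mu]_z (g x + (g1 x * c) * z + (g2 x * c ^+ 2 / 2) * z ^+ 2) =
    g x + g2 x * (c ^+ 2 * v / 2).
  have I0 := finite_measure_integrable_cst mu (g x) (@measurableT _ R).
  have I1 := integrableZl measurableT (g1 x * c) i1.
  have I2 := integrableZl measurableT (g2 x * c ^+ 2 / 2) i2.
  rewrite RintegralD//; last exact: (integrableD measurableT I0 I1).
  rewrite RintegralD// !RintegralZl// m1 m2 Rintegral_prob_cst; ring.
rewrite -Ep -RintegralB//.
have IB := integrableB measurableT Ig Ip.
apply: (le_trans (le_normr_Rintegral measurableT IB)).
rewrite /taylor_rest -RintegralZl//; last exact: integrable_taylor_rest cv.
apply: le_Rintegral => //.
- exact: (integrable_norm IB).
- exact: (integrableZl measurableT K (integrable_taylor_rest c cv)).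
move=> z _; apply: le_trans (tg x (c * z)); rewrite le_eqVlt; apply/orP; left.
by apply/eqP; congr (`| _ |); ring.
Qed.

Lemma bmeas_iter_conv mu c n g : bmeas g -> bmeas (iter n (conv mu c) g).
Proof. by move=> bg; elim: n => //= n; exact: bmeas_conv. Qed.

Lemma iter_conv_taylor2 mu c n K g g1 g2 : taylor2 K g g1 g2 ->
  taylor2 K (iter n (conv mu c) g) (iter n (conv mu c) g1)
    (iter n (conv mu c) g2).
Proof. by move=> tg; elim: n => //= n; exact: conv_taylor2. Qed.

(** Swapping the laws one at a time: [A^n.+1 - B^n.+1 =
    A (A^n - B^n) + (A - B) B^n], where [A] is a contraction for the uniform
    distance and [B^n g] keeps the Taylor bound of [g]. *)
Theorem lindeberg_exchange mu nu c c' K g g1 g2 v v' n x : 0 <= K ->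
  taylor2 K g g1 g2 -> centered_var mu v -> centered_var nu v' ->
  c ^+ 2 * v = c' ^+ 2 * v' ->
  `|iter n (conv mu c) g x - iter n (conv nu c') g x|
    <= n%:R * (K * (taylor_rest mu c + taylor_rest nu c')).
Proof.
move=> K0 tg cmu cnu vv'; elim: n x => [x|n IH x] /=.
  by rewrite subrr normr0 mul0r.
have bg : bmeas g by case: tg.
set h := iter n (conv nu c') g.
have := conv_dist mu c (bmeas_iter_conv mu c n bg) (bmeas_iter_conv nu c' n bg) IH x.
rewrite -/h => h1.
have th := iter_conv_taylor2 nu c' n tg.
have h2 := conv_expansion c x K0 th cmu; rewrite -/h vv' in h2.
have h3 := conv_expansion c' x K0 th cnu; rewrite -/h in h3.
rewrite (_ : _ - _ =
  (conv mu c (iter n (conv mu c) g) x - conv mu c h x)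
  + ((conv mu c h x - (h x + iter n (conv nu c') g2 x * (c' ^+ 2 * v' / 2)))
  - (conv nu c' h x - (h x + iter n (conv nu c') g2 x * (c' ^+ 2 * v' / 2)))));
  last by ring.
rewrite (le_trans (ler_normD _ _))// -(natr1 n) mulrDl mul1r lerD//.
by rewrite (le_trans (ler_normB _ _))// mulrDr lerD.
Qed.

(** A Taylor remainder of third order suffices: for steps larger than one the
    quadratic bound follows from the boundedness of the three functions. *)
Lemma taylor2_of_cubic K0 g g1 g2 M : 0 <= K0 -> 0 <= M ->
  measurable_fun setT g -> measurable_fun setT g1 -> measurable_fun setT g2 ->
  bounded_by M g -> bounded_by M g1 -> bounded_by M g2 ->
  (forall x h, `|g (x + h) - g x - g1 x * h - g2 x * (h ^+ 2 / 2)|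
     <= K0 * `|h| ^+ 3) ->
  taylor2 (K0 + 4 * M) g g1 g2.
Proof.
move=> K00 M0 mg mg1 mg2 bg bg1 bg2 tg; split; try by split => //; exists M.
move=> x h; have [h1|h1] := leP (h ^+ 2) (`|h| ^+ 3); last first.
  by rewrite (le_trans (tg x h))// ler_wpM2r ?exprn_ge0// lerDl mulr_ge0.
have [->|h0] := eqVneq h 0.
  by rewrite addr0 subrr expr0n/= mul0r !mulr0 !subr0 normr0.
have {h0 h1} h1 : 1 <= `|h|.
  move: h1; rewrite -real_normK ?num_real// (exprSr _ 2) ler_pMr//.
  by rewrite exprn_gt0// normr_gt0.
have hh : `|h| <= h ^+ 2 by rewrite -real_normK ?num_real// expr2 ler_peMr.
have h2 : 1 <= h ^+ 2 by exact: le_trans hh.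
apply: (@le_trans _ _ (M + M + M * `|h| + M * (h ^+ 2 / 2))).
  rewrite (le_trans (ler_normB _ _))//; apply: lerD.
    rewrite (le_trans (ler_normB _ _))//; apply: lerD.
      by rewrite (le_trans (ler_normB _ _))//; apply: lerD; exact: bg.
    by rewrite normrM ler_wpM2r//; exact: bg1.
  rewrite normrM (ger0_norm (_ : 0 <= h ^+ 2 / 2)) ?divr_ge0 ?sqr_ge0//.
  by rewrite ler_wpM2r ?divr_ge0 ?sqr_ge0//; exact: bg2.
by nra.
Qed.

End lindeberg.

(** * Densities of the normal laws *)

Section normal_law.
Context {R : realType}.
Notation leb := (@lebesgue_measure R).
Implicit Types (m s t : R).

(** The density and the Radon-Nikodym derivative have the same integral over
    every Borel set, hence coincide almost everywhere. *)
Lemma ge0_integral_normal m s (f : R -> \bar R) :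
  measurable_fun setT f -> (forall x, 0 <= f x)%E ->
  (\int[normal_prob m s]_x f x = \int[leb]_x (f x * (normal_pdf m s x)%:E))%E.
Proof.
move=> mf f0.
have dom : normal_prob m s `<< leb := normal_prob_dominates m s.
rewrite -(Radon_Nikodym_SigmaFinite.change_of_variables dom f0 measurableT mf).
apply: ae_eq_integral => //.
- apply: emeasurable_funM => //; apply: measurable_int.
  exact: (Radon_Nikodym_SigmaFinite.f_integrable dom).
- apply: emeasurable_funM => //.
  by apply/measurable_EFinP; exact: measurable_normal_pdf.
apply: ae_eqe_mul2l; apply: integral_ae_eq => //.
- exact: (Radon_Nikodym_SigmaFinite.f_integrable dom).
- by apply/measurable_EFinP; exact: measurable_normal_pdf.
- move=> E _ mE.
  by rewrite -(Radon_Nikodym_SigmaFinite.f_integral dom).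
Qed.

Lemma lebesgue_measure_shift h (A : set R) : measurable A ->
  pushforward leb ((fun x => x + h) : _ -> measurableTypeR R) A = leb A.
Proof.
move=> mA; apply/esym/lebesgue_measure_unique => //=.
  exact: (measurable_funD (@measurable_id _ _ setT) (measurable_cst h)).
move=> _ _ [[a b]] _ <-; rewrite /pushforward.
rewrite (_ : _ @^-1` _ = `]a - h, b - h]%classic); last first.
  by apply/seteqP; split => x /=; rewrite !in_itv/= ltrBlDr lerBrDr.
rewrite !lebesgue_measure_itv/= !lte_fin ltrD2r -!EFinB.
by rewrite (_ : b - h - (a - h) = b - a)//; ring.
Qed.

(** A transformation that preserves the Lebesgue measure and matches the
    densities maps one normal law to the other; used for translations and for
    the reflection. *)
Lemma integral_normal_comp m m' s (phi : R -> R) (f : R -> \bar R) : s != 0 ->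
  measurable_fun setT phi ->
  (forall A, measurable A ->
     pushforward leb (phi : _ -> measurableTypeR R) A = leb A) ->
  (forall x, normal_pdf m' s (phi x) = normal_pdf m s x) ->
  measurable_fun setT f -> (forall x, 0 <= f x)%E ->
  (\int[normal_prob m' s]_x f x = \int[normal_prob m s]_x f (phi x))%E.
Proof.
move=> s0 mphi phileb pdfphi mf f0.
have mphi' : measurable_fun [set: measurableTypeR R] (phi : _ -> measurableTypeR R).
  exact: mphi.
rewrite (ge0_integral_normal m' s mf f0).
rewrite (ge0_integral_normal m s (measurableT_comp mf mphi) (fun x => f0 (phi x))).
transitivity (\int[pushforward leb (phi : _ -> measurableTypeR R)]_x
    (f x * (normal_pdf m' s x)%:E))%E.
  by apply: eq_measure_integral => A mA _; exact/esym/phileb.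
have mfp : measurable_fun setT (fun x => f x * (normal_pdf m' s x)%:E)%E.
  apply: emeasurable_funM => //.
  by apply/measurable_EFinP; exact: measurable_normal_pdf.
have fp0 : {in [set: R], forall x, 0 <= f x * (normal_pdf m' s x)%:E}%E.
  by move=> x _; rewrite mule_ge0// lee_fin normal_pdf_ge0.
apply: (etrans (ge0_integral_pushforward mphi' leb measurableT mfp fp0)).
by apply: eq_integral => x _ /=; rewrite pdfphi.
Qed.

Lemma integral_normal_shift m h s (f : R -> \bar R) : s != 0 ->
  measurable_fun setT f -> (forall x, 0 <= f x)%E ->
  (\int[normal_prob (m + h) s]_x f x = \int[normal_prob m s]_x f (x + h)%R)%E.
Proof.
move=> s0 mf f0; apply: integral_normal_comp => //.
- by apply: measurable_funD.
- by move=> A mA; exact: lebesgue_measure_shift.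
- move=> x; rewrite !normal_pdfE// /normal_fun.
  by have -> : x + h - (m + h) = x - m by ring.
Qed.

Lemma integral_normal_opp s (f : R -> \bar R) : s != 0 ->
  measurable_fun setT f -> (forall x, 0 <= f x)%E ->
  (\int[normal_prob 0 s]_x f x = \int[normal_prob 0 s]_x f (- x)%R)%E.
Proof.
move=> s0 mf f0; apply: integral_normal_comp => //.
- by move=> A mA; exact: lebesgue_measureN.
- by move=> x; rewrite !normal_pdfE// /normal_fun !subr0 sqrrN.
Qed.

(** Completing the square in [z]: the left-hand side becomes, up to a factor
    that does not depend on [z], a normal density in [z], whose integral is
    one. *)
Lemma normal_pdf_mul (a b x z : R) : 0 < a -> 0 < b ->
  let v := a ^+ 2 + b ^+ 2 in
  normal_pdf 0 a z * normal_pdf z b x =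
  normal_pdf 0 (Num.sqrt v) x *
    normal_pdf (x * (a ^+ 2 / v)) (a * b / Num.sqrt v) z.
Proof.
move=> a0 b0 v.
have v0 : 0 < v by rewrite addr_gt0// exprn_gt0.
have sv0 : 0 < Num.sqrt v by rewrite sqrtr_gt0.
have svv : Num.sqrt v ^+ 2 = v by rewrite sqr_sqrtr// ltW.
have pi0 := pi_gt0 R.
rewrite !normal_pdfE ?gt_eqF ?divr_gt0 ?mulr_gt0//.
rewrite mulrACA [RHS]mulrACA; congr (_ * _).
  rewrite /normal_peak -!invfM; congr (_^-1).
  rewrite -!sqrtrM ?mulrn_wge0 ?mulr_ge0 ?sqr_ge0 ?ltW//; congr Num.sqrt.
  by rewrite !exprMn exprVn svv; field; rewrite gt_eqF.
rewrite /normal_fun -!expRD; congr expR.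
rewrite exprMn exprMn exprVn svv.
rewrite /v; field.
by rewrite !gt_eqF// (addr_gt0, exprn_gt0)//.
Qed.

(** Exponential tilting amounts to a translation: the centred density times
    [expR (t * x)] is a constant times the density of mean [t * s ^+ 2]. *)
Lemma normal_mgf t s : s != 0 ->
  (\int[normal_prob 0 s]_x (expR (t * x))%:E = (expR (t ^+ 2 * s ^+ 2 / 2))%:E)%E.
Proof.
move=> s0; have mf : measurable_fun setT (fun x : R => (expR (t * x))%:E).
  by apply/measurable_EFinP; apply: measurableT_comp => //; exact: measurable_funM.
rewrite (ge0_integral_normal 0 s mf); last by move=> x; rewrite lee_fin expR_ge0.
have tilt (x : R) : expR (t * x) * normal_pdf 0 s x =
    expR (t ^+ 2 * s ^+ 2 / 2) * normal_pdf (t * s ^+ 2) s x.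
  rewrite !normal_pdfE// mulrCA [RHS]mulrCA; congr (_ * _).
  by rewrite /normal_fun -!expRD; congr expR; field; exact: s0.
under eq_integral => x _ do rewrite -EFinM tilt EFinM.
rewrite ge0_integralZl//.
- by rewrite integral_normal_pdf mule1.
- by apply/measurable_EFinP; exact: measurable_normal_pdf.
- by move=> x _; rewrite lee_fin normal_pdf_ge0.
Qed.

End normal_law.

(** * Convolution of normal laws *)

(** [normal_prob] lives on [measurableTypeR R], whose display differs from the
    one of the Borel sets of [R] seen as the codomain of random variables;
    [gaussian] is the same measure on the latter. *)
Section gaussian.
Context {R : realType}.

Let id_borel : measurableTypeR R -> R := id.

Let measurable_id_borel : measurable_fun setT id_borel.
Proof. by move=> _ A mA; rewrite setTI. Qed.

HB.instance Definition _ :=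
  @isMeasurableFun.Build _ _ _ _ id_borel measurable_id_borel.

Definition gaussian (s : R) : probability R R :=
  distribution (normal_prob 0 s) id_borel.

Lemma ge0_integral_gaussian s (f : R -> \bar R) :
  measurable_fun setT f -> (forall x, 0 <= f x)%E ->
  (\int[gaussian s]_x f x = \int[normal_prob 0 s]_x f x)%E.
Proof. by move=> mf f0; rewrite ge0_integral_distribution. Qed.

Lemma integral_gaussian_bounded s (f : R -> R) : bmeas f ->
  (\int[gaussian s]_x (f x)%:E = \int[normal_prob 0 s]_x (f x)%:E)%E.
Proof.
move=> [mf bf]; rewrite integral_distribution//; first exact/measurable_EFinP.
exact: (@bmeas_integrable _ (measurableTypeR R)).
Qed.

End gaussian.

Section normal_conv.
Context {R : realType}.
Notation leb := (@lebesgue_measure R).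
Notation N := (@gaussian R).
Implicit Types (s t : R) (g : R -> R).

Lemma EFin_conv (mu : probability R R) c g x : bmeas g ->
  (conv mu c g x)%:E = (\int[mu]_z (g (x + c * z))%:E)%E.
Proof.
move=> bg; rewrite /conv /Rintegral fineK//.
apply: (integrable_fin_num measurableT).
exact/bmeas_integrable/bmeas_shift.
Qed.

Lemma conv_translate (mu : probability R R) c g x :
  conv mu c g x = conv mu c (fun y => g (x + y)) 0.
Proof. by apply: eq_Rintegral => z _; rewrite add0r. Qed.

Lemma conv_addr (mu : probability R R) c g M x : bmeas g ->
  conv mu c (fun y => g y + M) x = conv mu c g x + M.
Proof.
move=> bg; rewrite /conv RintegralD//.
- by rewrite Rintegral_prob_cst.
- exact/bmeas_integrable/bmeas_shift.
- exact: finite_measure_integrable_cst.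
Qed.

(** Absorbing the translation into the mean of the density gives the integral
    against the Lebesgue measure to which Tonelli's theorem applies. *)
Lemma conv_normalE s g x : s != 0 -> bmeas g -> (forall y, 0 <= g y) ->
  (conv (N s) 1 g x)%:E = (\int[leb]_u ((g u)%:E * (normal_pdf x s u)%:E))%E.
Proof.
move=> s0 bg g0; have mg : measurable_fun setT (EFin \o g).
  by apply/measurable_EFinP; case: bg.
rewrite EFin_conv// -(@ge0_integral_normal _ x s (EFin \o g))//.
have mgx : measurable_fun setT (fun z : R => (g (x + 1 * z))%:E).
  by apply/measurable_EFinP; apply: measurable_fun_shift; case: bg.
rewrite (ge0_integral_gaussian s mgx); last by move=> y; rewrite lee_fin.
rewrite -[in RHS](add0r x) (@integral_normal_shift _ 0 x s (EFin \o g))//.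
by apply: eq_integral => z _; rewrite /= mul1r addrC.
Qed.

Let conv_normal_ge0 (a b : R) g : 0 < a -> 0 < b -> bmeas g ->
  (forall y, 0 <= g y) ->
  conv (N a) 1 (conv (N b) 1 g) 0 = conv (N (Num.sqrt (a ^+ 2 + b ^+ 2))) 1 g 0.
Proof.
move=> a0 b0 bg g0.
set v := a ^+ 2 + b ^+ 2.
have v0 : 0 < v by rewrite addr_gt0// exprn_gt0.
have sv0 : 0 < Num.sqrt v by rewrite sqrtr_gt0.
apply: EFin_inj.
have mpdf m s : measurable_fun setT (fun y : R => (normal_pdf m s y)%:E).
  by apply/measurable_EFinP; exact: measurable_normal_pdf.
have cg0 y : 0 <= conv (N b) 1 g y by apply: Rintegral_ge0 => z _.
have E1 := conv_normalE 0 (lt0r_neq0 a0) (bmeas_conv (N b) 1 bg) cg0.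
have E2 := conv_normalE 0 (lt0r_neq0 sv0) bg g0.
apply: (etrans E1); apply: etrans (esym E2); clear E1 E2.
have mg : measurable_fun setT g by case: bg.
pose F (p : measurableTypeR R * measurableTypeR R) :=
  (g p.2 * normal_pdf 0 a p.1 * normal_pdf p.1 b p.2)%:E.
have mR (f : R -> R) : measurable_fun setT f ->
  measurable_fun [set: measurableTypeR R] f by [].
have mF : measurable_fun setT F.
  apply/measurable_EFinP; apply: measurable_funM.
    apply: measurable_funM; first exact: measurableT_comp (mR _ mg) measurable_snd.
    by apply: (measurableT_comp (mR _ (measurable_normal_pdf 0 a)) measurable_fst).
  rewrite (_ : (fun _ => _) =
      (fun p : measurableTypeR R * measurableTypeR R =>
         normal_pdf 0 b ((p.2 : R) - (p.1 : R)))).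
    apply: (measurableT_comp (measurable_normal_pdf 0 b)).
    have m1 : measurable_fun setT
        (fun p : measurableTypeR R * measurableTypeR R => p.1 : R).
      exact: (measurableT_comp (mR _ (@measurable_id _ _ setT)) measurable_fst).
    have m2 : measurable_fun setT
        (fun p : measurableTypeR R * measurableTypeR R => p.2 : R).
      exact: (measurableT_comp (mR _ (@measurable_id _ _ setT)) measurable_snd).
    exact: measurable_funB m2 m1.
  by apply/funext => p; rewrite !normal_pdfE ?gt_eqF// /normal_fun subr0.
have F0 p : (0 <= F p)%E.
  by rewrite lee_fin !mulr_ge0// ?normal_pdf_ge0.
transitivity (\int[leb]_y \int[leb]_u F (y, u))%E.
  apply: eq_integral => y _.
  rewrite (conv_normalE y (lt0r_neq0 b0) bg g0) -ge0_integralZr//.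
  - by apply: eq_integral => u _; rewrite /F -!EFinM /=; congr EFin; ring.
  - apply: emeasurable_funM; last exact: mpdf.
    exact: (measurableT_comp (@EFin_measurable R setT) mg).
  - move=> u _; rewrite -EFinM lee_fin.
    exact: mulr_ge0 (g0 u) (normal_pdf_ge0 _ _ _).
  - by rewrite lee_fin normal_pdf_ge0.
transitivity (\int[leb]_u \int[leb]_y F (y, u))%E.
  exact: (@fubini_tonelli _ _ _ _ R leb leb F mF F0).
apply: eq_integral => u _.
have FE y : F (y, u) = ((g u * normal_pdf 0 (Num.sqrt v) u)%:E *
    (normal_pdf (u * (a ^+ 2 / v)) (a * b / Num.sqrt v) y)%:E)%E.
  by rewrite /F /= -mulrA normal_pdf_mul// -!EFinM; congr EFin; rewrite /v; ring.
under eq_integral => y _ do rewrite FE.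
rewrite ge0_integralZl//.
- by rewrite integral_normal_pdf mule1 EFinM.
- exact: mpdf.
- by move=> y _; rewrite lee_fin normal_pdf_ge0.
- by rewrite lee_fin; exact: mulr_ge0 (g0 u) (normal_pdf_ge0 _ _ _).
Qed.

(** The case of an arbitrary base point and of a function of any sign follows
    by translating [g] and by adding a constant to it. *)
Lemma conv_normal (a b : R) g x : 0 < a -> 0 < b -> bmeas g ->
  conv (N a) 1 (conv (N b) 1 g) x = conv (N (Num.sqrt (a ^+ 2 + b ^+ 2))) 1 g x.
Proof.
move=> a0 b0 bg; have [mg [M gM]] := bg.
rewrite conv_translate [RHS]conv_translate.
pose h y := g (x + y).
have bh : bmeas h.
  by have := bmeas_shift 1 x bg; rewrite (_ : (fun _ => _) = h)//;
     apply/funext => z; rewrite mul1r.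
have -> : (fun y => conv (N b) 1 g (x + y)) = conv (N b) 1 h.
  by apply/funext => y; apply: eq_Rintegral => z _; rewrite /h addrA.
have bhM : bmeas (fun y => h y + M).
  split; first by apply: measurable_funD => //; case: bh.
  exists (M + `|M|) => y; rewrite (le_trans (ler_normD _ _))// lerD2r.
  exact: gM.
have hM0 y : 0 <= h y + M.
  by rewrite -lerBlDr sub0r; have := gM (x + y); rewrite ler_norml => /andP[].
have E := conv_normal_ge0 a0 b0 bhM hM0.
have E1 : conv (N b) 1 (fun y => h y + M) = (fun y => conv (N b) 1 h y + M).
  by apply/funext => y; exact: conv_addr.
rewrite E1 (conv_addr (N a) 1 M 0 (bmeas_conv (N b) 1 bh)) in E.
by rewrite (conv_addr (N _) 1 M 0 bh) in E; exact: addIr E.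
Qed.

(** This stability is what makes the normal law the limit in the central limit
    theorem. *)
Lemma iter_conv_normal s n g x : 0 < s -> bmeas g ->
  iter n.+1 (conv (N s) 1) g x = conv (N (Num.sqrt n.+1%:R * s)) 1 g x.
Proof.
move=> s0 bg; elim: n x => [|n IH] x; first by rewrite sqrtr1 mul1r.
rewrite iterS (_ : iter n.+1 _ g = conv (N (Num.sqrt n.+1%:R * s)) 1 g); last first.
  exact/funext.
have t0 : 0 < Num.sqrt n.+1%:R * s by rewrite mulr_gt0// sqrtr_gt0 ltr0n.
rewrite (conv_normal x s0 t0 bg).
have -> : Num.sqrt (s ^+ 2 + (Num.sqrt n.+1%:R * s) ^+ 2) = Num.sqrt n.+2%:R * s.
  rewrite exprMn sqr_sqrtr ?ler0n// -[X in X + _](mul1r (s ^+ 2)) -mulrDl.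
  by rewrite sqrtrM ?addr_ge0// sqrtr_sqr gtr0_norm// nat1r.
by [].
Qed.

End normal_conv.

(** * Moments of the normal laws *)

Section gaussian_moments.
Context {R : realType}.
Notation N := (@gaussian R).
Implicit Types (s t : R).

Lemma expR_norm_le (x : R) : expR `|x| <= expR x + expR (- x).
Proof.
have [x0|x0] := leP 0 x; first by rewrite ger0_norm// lerDl expR_ge0.
by rewrite ltr0_norm// lerDr expR_ge0.
Qed.

Lemma measurable_expRM t : measurable_fun [set: R] (fun x : R => expR (t * x)).
Proof. exact: (measurableT_comp (@measurable_expR R) (mulrl_measurable t)). Qed.

Lemma integral_gaussian_expR t s : s != 0 ->
  (\int[N s]_x (expR (t * x))%:E = (expR (t ^+ 2 * s ^+ 2 / 2))%:E)%E.
Proof.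
move=> s0; rewrite -(normal_mgf t s0); apply: ge0_integral_gaussian.
  by apply/measurable_EFinP; exact: measurable_expRM.
by move=> x; rewrite lee_fin expR_ge0.
Qed.

Lemma integrable_gaussian_expR t s : s != 0 ->
  (N s).-integrable setT (EFin \o (fun x => expR (t * x))).
Proof.
move=> s0; apply/integrableP; split.
  by apply/measurable_EFinP; exact: measurable_expRM.
under eq_integral => x _ do rewrite /= ger0_norm ?expR_ge0//.
by rewrite integral_gaussian_expR// ltry.
Qed.

Lemma Rintegral_gaussian_expR t s : s != 0 ->
  \int[N s]_x expR (t * x) = expR (t ^+ 2 * s ^+ 2 / 2).
Proof. by move=> s0; rewrite /Rintegral integral_gaussian_expR. Qed.

Lemma integrable_gaussian_cosh (k C s : R) : s != 0 ->
  (N s).-integrable setT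
    (EFin \o (fun x => C * (expR (k * x) + expR (- k * x)))).
Proof.
move=> s0; have I := integrableD measurableT
  (integrable_gaussian_expR k s0) (integrable_gaussian_expR (- k) s0).
exact: (integrableZl measurableT C I).
Qed.

Lemma integrable_gaussian_dominated (f : R -> R) (k C s : R) : s != 0 ->
  measurable_fun setT f ->
  (forall x, `|f x| <= C * (expR (k * x) + expR (- k * x))) ->
  (N s).-integrable setT (EFin \o f).
Proof.
move=> s0 mf fC; apply: (le_integrable measurableT _ _
  (integrable_gaussian_cosh k C s0)); first exact/measurable_EFinP.
by move=> x _ /=; rewrite lee_fin (le_trans (fC x))// ler_norm.
Qed.

Lemma Rintegral_gaussian_dominated (f : R -> R) (k C s : R) : s != 0 ->
  measurable_fun setT f ->
  (forall x, `|f x| <= C * (expR (k * x) + expR (- k * x))) ->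
  \int[N s]_x f x <= C * (expR (k ^+ 2 * s ^+ 2 / 2) *+ 2).
Proof.
move=> s0 mf fC.
have -> : C * (expR (k ^+ 2 * s ^+ 2 / 2) *+ 2) =
    \int[N s]_x (C * (expR (k * x) + expR (- k * x))).
  have I := integrableD measurableT
    (integrable_gaussian_expR k s0) (integrable_gaussian_expR (- k) s0).
  rewrite RintegralZl//.
  rewrite RintegralD//; try exact: integrable_gaussian_expR.
  by rewrite !Rintegral_gaussian_expR// sqrrN mulr2n.
apply: le_Rintegral => //.
- exact: integrable_gaussian_dominated fC.
- exact: integrable_gaussian_cosh.
- by move=> x _; rewrite (le_trans _ (fC x))// ler_norm.
Qed.

Lemma integrable_gaussian_id s : s != 0 ->
  (N s).-integrable setT (EFin \o (fun x => x)).
Proof.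
move=> s0; apply: (@integrable_gaussian_dominated _ 1 1) => // x.
rewrite mulN1r !mul1r (le_trans _ (expR_norm_le x))//.
by rewrite (le_trans _ (expR_ge1Dx _))// lerDr.
Qed.

(** The law is invariant under the reflection, which exchanges the positive and
    the negative part of the identity. *)
Lemma gaussian_mean0 s : s != 0 -> \int[N s]_x x = 0.
Proof.
move=> s0; rewrite /Rintegral integralE.
have mE : measurable_fun [set: R] (fun x : R => x%:E).
  exact/measurable_EFinP.
have mp : measurable_fun setT ((fun x : R => x%:E)^\+)%E.
  exact: measurable_funepos.
have mn : measurable_fun setT ((fun x : R => x%:E)^\-)%E.
  exact: measurable_funeneg.
have p0 x : (0 <= (fun x : R => x%:E)^\+ x)%E by exact: funepos_ge0.
have n0 x : (0 <= (fun x : R => x%:E)^\- x)%E by exact: funeneg_ge0.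
have -> : (\int[N s]_x (fun x : R => x%:E)^\+ x =
           \int[N s]_x (fun x : R => x%:E)^\- x)%E.
  rewrite (ge0_integral_gaussian s mp p0) (ge0_integral_gaussian s mn n0).
  rewrite (integral_normal_opp s0 mp p0); apply: eq_integral => x _.
  by rewrite funeposE funenegE EFinN.
rewrite subee//.
exact: (integrable_neg_fin_num measurableT (integrable_gaussian_id s0)).
Qed.

Lemma expR_sub1_bounds (u : R) : u <= expR u - 1 <= u * expR u.
Proof.
rewrite lerBrDl expR_ge1Dx /= lerBlDr -lerBlDl.
have := expR_ge1Dx (- u); rewrite -(ler_pM2r (expR_gt0 u)) expRN.
by rewrite mulVf ?gt_eqF ?expR_gt0// mulrBl mul1r.
Qed.

Lemma cvg_expR_harmonic (c : R) :
  expR (c * n.+1%:R^-1) @[n --> \oo] --> (1 : R).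
Proof.
have H : (c * n.+1%:R^-1 : R) @[n --> \oo] --> c * 0.
  by apply: cvgM; [exact: cvg_cst|exact: cvg_harmonic].
have := cvg_comp _ _ H (@continuous_expR R (c * 0)).
by rewrite mulr0 expR0.
Qed.

(** The derivative of the exponential at 0, along the sequence [1 / n.+1];
    both bounds of [expR_sub1_bounds] are needed since [z] has any sign. *)
Lemma cvg_expR_quotient (z : R) :
  (expR (n.+1%:R^-1 * z) - 1) * n.+1%:R @[n --> \oo] --> z.
Proof.
have t0 (n : nat) : 0 < n.+1%:R :> R by rewrite ltr0n.
apply: (@squeeze_cvgr _ _ _ _ (fun=> z) (fun n => z * expR (z * n.+1%:R^-1))).
- apply: nearW => n; have /andP[h1 h2] := expR_sub1_bounds (n.+1%:R^-1 * z).
  rewrite (mulrC _ z) in h1 h2 *.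
  apply/andP; split; first by rewrite -ler_pdivrMr.
  by rewrite -ler_pdivlMr// mulrAC.
- exact: cvg_cst.
- rewrite -[X in _ --> X]mulr1; by apply: cvgM; [exact: cvg_cst|exact: cvg_expR_harmonic].
Qed.

Lemma sqr_le_expR (x : R) : x ^+ 2 <= 2 * expR `|x|.
Proof.
rewrite -real_normK ?num_real// -ler_pdivrMl// mulrC.
by rewrite (le_trans _ (expR_ge1Dxn 1 (normr_ge0 x)))// lerDr.
Qed.

(** A majorant that does not depend on [t], for dominated convergence.  The
    numerator is the square of [expR w - expR (- w)] with [w = t * z / 2]. *)
Lemma cosh_quotient_le (t z : R) : 0 < t -> t <= 1 ->
  (expR (t * z) + expR (- t * z) - 2) / t ^+ 2
    <= 2 * (expR (2 * z) + expR (- 2 * z)).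
Proof.
move=> t0 t1.
pose w := t * z / 2.
have -> : expR (t * z) + expR (- t * z) - 2 = (expR w - expR (- w)) ^+ 2.
  rewrite sqrrB -!expRM_natl -expRD subrr expR0 /w.
  have -> : 2%:R * (t * z / 2) = t * z :> R by field.
  have -> : 2%:R * - (t * z / 2) = - t * z :> R by field.
  by rewrite addrAC.
have h : `|expR w - expR (- w)| <= 2 * `|w| * expR `|w|.
  have /andP[h1 h2] := expR_sub1_bounds (w *+ 2).
  have e1 : expR w - expR (- w) = expR (- w) * (expR (w *+ 2) - 1).
    by rewrite mulrBr -expRD mulr1 mulr2n addrA addNr add0r.
  rewrite ler_norml e1; apply/andP; split.
    apply: (@le_trans _ _ (expR (- w) * (w *+ 2))); last first.
      by rewrite ler_wpM2l ?expR_ge0.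
    rewrite lerNl (_ : - _ = 2 * (- w * expR (- w))); last by ring.
    rewrite -[leRHS]mulrA ler_pM2l//.
    apply: (@le_trans _ _ (`|w| * expR (- w))).
      by rewrite ler_wpM2r ?expR_ge0// -normrN ler_norm.
    by rewrite ler_wpM2l// ler_expR -normrN ler_norm.
  apply: (@le_trans _ _ (expR (- w) * (w *+ 2 * expR (w *+ 2)))).
    by rewrite ler_wpM2l ?expR_ge0.
  rewrite mulrCA -expRD (_ : - w + w *+ 2 = w); last by ring.
  rewrite -mulr_natl -[leLHS]mulrA -[leRHS]mulrA ler_pM2l//.
  apply: (@le_trans _ _ (`|w| * expR w)).
    by rewrite ler_wpM2r ?expR_ge0// ler_norm.
  by rewrite ler_wpM2l// ler_expR ler_norm.
rewrite ler_pdivrMr ?exprn_gt0// -[leLHS]real_normK ?num_real//.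
apply: (@le_trans _ _ ((2 * `|w| * expR `|w|) ^+ 2)).
  by rewrite ler_pXn2r ?nnegrE ?mulr_ge0 ?expR_ge0.
have -> : (2 * `|w| * expR `|w|) ^+ 2 = z ^+ 2 * expR `|t * z| * t ^+ 2.
  rewrite !exprMn -expRM_natl real_normK ?num_real//.
  have -> : 2%:R * `|w| = `|t * z|.
    have h2 : 0 <= 2^-1 :> R by rewrite invr_ge0.
    by rewrite /w (normrM (t * z)) (ger0_norm h2); field.
  by rewrite /w; field.
apply: ler_wpM2r; first exact: sqr_ge0.
apply: (@le_trans _ _ (2 * expR `|z| * expR `|z|)).
  apply: ler_pM; rewrite ?sqr_ge0 ?expR_ge0 ?sqr_le_expR//.
  by rewrite ler_expR normrM gtr0_norm// ler_piMl.
rewrite -mulrA ler_pM2l// -expRD.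
have -> : `|z| + `|z| = `|2 * z| by rewrite normrM normr_nat; ring.
by rewrite mulNr; exact: expR_norm_le.
Qed.

Lemma cvg_cosh_quotient (z : R) :
  (expR (n.+1%:R^-1 * z) + expR (- n.+1%:R^-1 * z) - 2) / n.+1%:R^-1 ^+ 2
    @[n --> \oo] --> z ^+ 2.
Proof.
have h1 := @cvg_expR_quotient z.
have h2 := @cvg_expR_harmonic (- z).
have h3 := cvgM (cvgM h1 h1) h2; rewrite mulr1 -expr2 in h3.
suff -> : (fun n : nat => (expR (n.+1%:R^-1 * z) + expR (- n.+1%:R^-1 * z) - 2)
    / n.+1%:R^-1 ^+ 2) = (fun n : nat => (expR (n.+1%:R^-1 * z) - 1) * n.+1%:R *
    ((expR (n.+1%:R^-1 * z) - 1) * n.+1%:R) * expR (- z * n.+1%:R^-1)); first exact: h3.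
apply/funext => n; set t : R := n.+1%:R^-1.
have -> : n.+1%:R = t^-1 :> R by rewrite invrK.
have -> : expR (- t * z) = expR (- z * t) by rewrite mulNr mulNr mulrC.
have t0 : t != 0 by rewrite invr_eq0 pnatr_eq0.
have e : expR (t * z) * expR (- z * t) = 1.
  by rewrite -expRD mulNr (mulrC z) subrr expR0.
set E := expR (t * z) in e *; set F := expR (- z * t) in e *.
have -> : (E - 1) / t * ((E - 1) / t) * F =
    ((E * (E * F) - 2 * (E * F) + F) / t ^+ 2) by field.
by rewrite e !mulr1 addrAC.
Qed.

Lemma integrable_gaussian_sqr s : s != 0 ->
  (N s).-integrable setT (EFin \o (fun x => x ^+ 2)).
Proof.
move=> s0; apply: (@integrable_gaussian_dominated _ 1 2) => // x.
rewrite mulN1r !mul1r ger0_norm ?sqr_ge0// (le_trans (sqr_le_expR x))//.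
by rewrite ler_pM2l// expR_norm_le.
Qed.

(** The second difference quotient at 0 of the moment generating function tends
    to the second moment on the one hand, by dominated convergence, and to
    [s ^+ 2] on the other hand, by its explicit value. *)
Lemma gaussian_variance s : s != 0 -> \int[N s]_x x ^+ 2 = s ^+ 2.
Proof.
move=> s0.
pose t (n : nat) : R := n.+1%:R^-1.
have t0 n : 0 < t n by rewrite invr_gt0 ltr0n.
have t1 n : t n <= 1 by rewrite invf_le1 ?ltr0n// ler1n.
pose f n (z : R) := (expR (t n * z) + expR (- t n * z) - 2) / t n ^+ 2.
have mf n : measurable_fun setT (f n).
  apply: measurable_funM => //; apply: measurable_funB => //.
  by apply: measurable_funD; exact: measurable_expRM.
have f0 n z : 0 <= f n z.
  apply: divr_ge0; last exact: sqr_ge0.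
  rewrite subr_ge0 mulNr.
  by rewrite (_ : 2 = (1 + t n * z) + (1 - t n * z))//; [apply: lerD; exact: expR_ge1Dx|ring].
have If n : \int[N s]_x f n x = (expR (t n ^+ 2 * s ^+ 2 / 2) *+ 2 - 2) / t n ^+ 2.
  have I := integrableD measurableT
    (integrable_gaussian_expR (t n) s0) (integrable_gaussian_expR (- t n) s0).
  have Ic := finite_measure_integrable_cst (N s) (2 : R) (@measurableT _ R).
  have IB := integrableB measurableT I Ic.
  rewrite RintegralZr// RintegralB// RintegralD//; try exact: integrable_gaussian_expR.
  by rewrite !Rintegral_gaussian_expR// Rintegral_prob_cst sqrrN mulr2n.
have lim1 : ((\int[N s]_x (f n x)%:E)%E @[n --> \oo] --> \int[N s]_x (x ^+ 2)%:E)%E.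
  apply: (@dominated_cvg _ _ _ (N s) setT measurableT (fun n x => (f n x)%:E) _
    (fun x => (2 * (expR (2 * x) + expR (- 2 * x)))%:E)).
  - by move=> n; exact/measurable_EFinP.
  - by move=> x _; apply/cvg_EFin; [exact: nearW|exact: cvg_cosh_quotient].
  - by [].
  - exact: (integrable_gaussian_cosh 2 2 s0).
  - move=> n x _; rewrite lee_fin ger0_norm//; exact: cosh_quotient_le.
have lim2 : (\int[N s]_x f n x) @[n --> \oo] --> s ^+ 2.
  pose u n := t n ^+ 2 * s ^+ 2 / 2.
  have eu n : \int[N s]_x f n x = s ^+ 2 * ((expR (u n) - 1) / u n).
    by rewrite If /u -mulr_natr; field; rewrite s0 gt_eqF.
  have s20 : 0 < s ^+ 2 by rewrite exprn_even_gt0.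
  have u0 n : 0 < u n by rewrite divr_gt0// mulr_gt0// exprn_gt0.
  apply: (@squeeze_cvgr _ _ _ _ (fun=> s ^+ 2)
    (fun n => s ^+ 2 * expR (s ^+ 2 / 2 * t n))).
  - apply: nearW => n; rewrite eu.
    have /andP[h1 h2] := expR_sub1_bounds (u n).
    rewrite -{1}(mulr1 (s ^+ 2)) !ler_wpM2l ?sqr_ge0//=; last first.
      by rewrite ler_pdivlMr// mul1r.
    rewrite ler_pdivrMr// (le_trans h2)// mulrC ler_wpM2r ?(ltW (u0 n))//.
    rewrite ler_expR /u -mulrA mulrC ler_wpM2l ?divr_ge0 ?sqr_ge0//.
    by rewrite expr2 ler_piMl// ltW.
  - exact: cvg_cst.
  - rewrite -[X in _ --> X]mulr1.
    by apply: cvgM; [exact: cvg_cst|exact: cvg_expR_harmonic].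
have i2 := integrable_gaussian_sqr s0.
have E2 : (\int[N s]_x (x ^+ 2)%:E)%E = (\int[N s]_x (x ^+ 2))%:E.
  by rewrite /Rintegral fineK//; exact: (integrable_fin_num measurableT i2).
rewrite E2 in lim1; exact: (cvg_unique _ (fine_cvg lim1) lim2).
Qed.

Lemma gaussian_centered_var s : s != 0 -> centered_var (N s) (s ^+ 2).
Proof.
move=> s0; split; [exact: integrable_gaussian_id|exact: gaussian_mean0|
  exact: integrable_gaussian_sqr|exact: gaussian_variance].
Qed.

(** The third absolute moment scales as the cube of the standard deviation;
    its finiteness comes from [u ^+ 3 <= 6 * expR u] with [u = `|x| / s]. *)
Lemma taylor_rest_gaussian s : 0 < s ->
  taylor_rest (N s) 1 <= 12 * expR (1 / 2) * s ^+ 3.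
Proof.
move=> s0; have s0' : s != 0 by rewrite gt_eqF.
have -> : 12 * expR (1 / 2) * s ^+ 3 =
    6 * s ^+ 3 * (expR (s^-1 ^+ 2 * s ^+ 2 / 2) *+ 2).
  by rewrite -exprMn mulVf// expr1n; ring.
apply: Rintegral_gaussian_dominated => // [|x].
  exact: measurable_taylor_rest.
rewrite mul1r ger0_norm; last by rewrite le_min sqr_ge0 exprn_ge0.
apply: (@le_trans _ _ (6 * s ^+ 3 * expR `|s^-1 * x|)); last first.
  by rewrite ler_pM2l ?mulr_gt0 ?exprn_gt0// mulNr expR_norm_le.
rewrite ge_min; apply/orP; right.
have -> : `|x| = s * `|s^-1 * x|.
  by rewrite normrM gtr0_norm ?invr_gt0// mulVKf.
rewrite exprMn (mulrC 6) -[leRHS]mulrA ler_pM2l ?exprn_gt0//.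
rewrite -ler_pdivrMl// mulrC.
by rewrite (le_trans _ (expR_ge1Dxn 2 (normr_ge0 (s^-1 * x))))// lerDr.
Qed.

End gaussian_moments.

(** * Smooth steps and spline approximation *)

Section step.
Context {R : realType}.
Implicit Types (x h : R).

Definition pos x := Num.max 0 x.

Lemma posP x : (x <= 0 /\ pos x = 0) \/ (0 <= x /\ pos x = x).
Proof.
by rewrite /pos; have [x0|/ltW x0] := leP x 0; [left|right].
Qed.

Lemma measurable_pos : measurable_fun setT pos.
Proof. by apply: measurable_maxr. Qed.

(** Third differences of the truncated powers: [step] is the distribution
    function of the sum of three uniform variables on [0, 1]. *)
Definition diff3 (f : R -> R) x := f x - 3 * f (x - 1) + 3 * f (x - 2) - f (x - 3).
Definition step x := diff3 (fun y => pos y ^+ 3 / 6) x.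
Definition step1 x := diff3 (fun y => pos y ^+ 2 / 2) x.
Definition step2 x := diff3 pos x.

(** Taylor's inequality for [pos x ^+ 3 / 6], whose second derivative [pos] is
    Lipschitz.  It is checked on the four positions of [x] and [x + h] with
    respect to 0. *)
Lemma pos_cubic x h :
  `|pos (x + h) ^+ 3 / 6 - pos x ^+ 3 / 6 - pos x ^+ 2 / 2 * h
    - pos x * (h ^+ 2 / 2)| <= `|h| ^+ 3.
Proof.
have cube_le (a b : R) : 0 <= a -> a <= b -> 0 <= a ^+ 3 <= b ^+ 3.
  move=> a0 ab; rewrite exprn_ge0//= ler_pXn2r// nnegrE//.
  exact: le_trans ab.
have [[x0 ->]|[x0 ->]] := posP x; have [[xh ->]|[xh ->]] := posP (x + h).
- rewrite (_ : _ - _ = 0); last by field.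
  by rewrite normr0 exprn_ge0.
- have /andP[c1 c2] := cube_le _ h xh ltac:(lra).
  rewrite (ger0_norm (_ : 0 <= h)); last by lra.
  rewrite (_ : _ - _ = (x + h) ^+ 3 / 6); last by field.
  by rewrite ger0_norm; lra.
- have /andP[c1 c2] := cube_le (- (x + h)) (- h) ltac:(lra) ltac:(lra).
  rewrite (ler0_norm (_ : h <= 0)); last by lra.
  rewrite (_ : _ - _ = ((- (x + h)) ^+ 3 - (- h) ^+ 3) / 6); last by field.
  by rewrite ler0_norm; lra.
- rewrite (_ : _ - _ = h ^+ 3 / 6); last by field.
  by rewrite normrM normrX (ger0_norm (_ : 0 <= 6^-1)) ?invr_ge0// ler_piMr ?exprn_ge0//; lra.
Qed.

Lemma step_cubic x h :
  `|step (x + h) - step x - step1 x * h - step2 x * (h ^+ 2 / 2)|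
     <= 8 * `|h| ^+ 3.
Proof.
rewrite /step /step1 /step2 /diff3.
have e (c : R) : x + h - c = x - c + h by rewrite addrAC.
rewrite !e.
have h0 := pos_cubic x h; have h1 := pos_cubic (x - 1) h.
have h2 := pos_cubic (x - 2) h; have h3 := pos_cubic (x - 3) h.
rewrite (_ : `| _ | = `| (pos (x + h) ^+ 3 / 6 - pos x ^+ 3 / 6
   - pos x ^+ 2 / 2 * h - pos x * (h ^+ 2 / 2))
 - 3 * (pos (x - 1 + h) ^+ 3 / 6 - pos (x - 1) ^+ 3 / 6
   - pos (x - 1) ^+ 2 / 2 * h - pos (x - 1) * (h ^+ 2 / 2))
 + 3 * (pos (x - 2 + h) ^+ 3 / 6 - pos (x - 2) ^+ 3 / 6
   - pos (x - 2) ^+ 2 / 2 * h - pos (x - 2) * (h ^+ 2 / 2))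
 - (pos (x - 3 + h) ^+ 3 / 6 - pos (x - 3) ^+ 3 / 6
   - pos (x - 3) ^+ 2 / 2 * h - pos (x - 3) * (h ^+ 2 / 2))|); last first.
  by congr (`| _ |); ring.
move: h0 h1 h2 h3; rewrite !ler_norml => /andP[a1 a2] /andP[b1 b2].
by move=> /andP[c1 c2] /andP[d1 d2]; apply/andP; split; lra.
Qed.

Lemma measurable_diff3 (f : R -> R) :
  measurable_fun setT f -> measurable_fun setT (diff3 f).
Proof.
move=> mf; have ms c : measurable_fun setT (fun x => f (x - c)).
  by apply: measurableT_comp => //; exact: measurable_funB.
apply: measurable_funB => //; apply: measurable_funD.
  by apply: measurable_funB => //; exact: measurable_funM.
exact: measurable_funM.
Qed.

Lemma measurable_step : measurable_fun setT step.
Proof.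
apply: measurable_diff3; apply: measurable_funM => //.
by apply: measurable_funX; exact: measurable_pos.
Qed.

Lemma measurable_step1 : measurable_fun setT step1.
Proof.
apply: measurable_diff3; apply: measurable_funM => //.
by apply: measurable_funX; exact: measurable_pos.
Qed.

Lemma measurable_step2 : measurable_fun setT step2.
Proof. by apply: measurable_diff3; exact: measurable_pos. Qed.

Lemma pos_nonpos x : x <= 0 -> pos x = 0. Proof. by move=> x0; rewrite /pos max_l. Qed.
Lemma pos_nonneg x : 0 <= x -> pos x = x. Proof. by move=> x0; rewrite /pos max_r. Qed.

Lemma step_le0 x : x <= 0 -> step x = 0.
Proof.
by move=> x0; rewrite /step /diff3 !pos_nonpos; try lra; rewrite ?expr0n/=; lra.
Qed.

Lemma step_ge3 x : 3 <= x -> step x = 1.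
Proof.
by move=> x0; rewrite /step /diff3 !pos_nonneg; try lra; field.
Qed.

Lemma step_bounds x : [/\ `|step x| <= 36, `|step1 x| <= 36 & `|step2 x| <= 36].
Proof.
have [x3|x3] := leP 3 x.
  have -> : step1 x = 0.
    by rewrite /step1 /diff3 !pos_nonneg; try lra; field.
  have -> : step2 x = 0 by rewrite /step2 /diff3 !pos_nonneg; lra.
  by rewrite step_ge3// normr1 normr0; split; lra.
have p3 c : 0 <= c -> 0 <= pos (x - c) <= 3.
  by move=> c0; have [[_ ->]|[? ->]] := posP (x - c); lra.
have sq (a : R) : 0 <= a <= 3 -> 0 <= a ^+ 2 <= 9.
  by move=> /andP[? ?]; apply/andP; split; nra.
have cu (a : R) : 0 <= a <= 3 -> 0 <= a ^+ 3 <= 27.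
  move=> a3; have /andP[? ?] := sq a a3; move: a3 => /andP[? ?].
  by rewrite exprS; apply/andP; split; nra.
have a0 : 0 <= pos x <= 3 by rewrite -(subr0 x); apply: p3.
have a1 : 0 <= pos (x - 1) <= 3 by apply: p3.
have a2 : 0 <= pos (x - 2) <= 3 by apply: p3.
have a3 : 0 <= pos (x - 3) <= 3 by apply: p3.
rewrite /step /step1 /step2 /diff3 !ler_norml.
have := (cu _ a0, cu _ a1, cu _ a2, cu _ a3).
have := (sq _ a0, sq _ a1, sq _ a2, sq _ a3).
by move=> /= [[[? ?] ?] ?] [[[? ?] ?] ?]; split; lra.
Qed.

Lemma taylor2_step : taylor2 152 step step1 step2.
Proof.
rewrite (_ : 152 = 8 + 4 * 36); last by lra.
apply: taylor2_of_cubic => //.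
- exact: measurable_step.
- exact: measurable_step1.
- exact: measurable_step2.
- by move=> x; case: (step_bounds x).
- by move=> x; case: (step_bounds x).
- by move=> x; case: (step_bounds x).
- exact: step_cubic.
Qed.

(** The increment is the cubic B-spline with knots 0, 1, 2, 3, 4, which is a
    probability density; its sign is read off its polynomial on each of the
    intervals between knots. *)
Lemma step_increment_ge0 x : 0 <= step x - step (x - 1).
Proof.
have cube_ge0 (a : R) : 0 <= a -> 0 <= a ^+ 3 by move=> ?; exact: exprn_ge0.
rewrite /step /diff3.
rewrite (_ : x - 1 - 1 = x - 2); last by ring.
rewrite (_ : x - 1 - 2 = x - 3); last by ring.
rewrite (_ : x - 1 - 3 = x - 4); last by ring.
have [x0|x0] := leP x 0; first by rewrite !pos_nonpos; try lra; rewrite ?expr0n/=; lra.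
have [x1|x1] := leP x 1.
  rewrite (pos_nonneg (ltW x0)) !pos_nonpos; try lra.
  have := cube_ge0 x (ltW x0); rewrite ?expr0n/=; lra.
have [x2|x2] := leP x 2.
  rewrite (pos_nonneg (ltW x0)) (@pos_nonneg (x - 1)); last by lra.
  rewrite !pos_nonpos; try lra.
  have := cube_ge0 x (ltW x0); rewrite ?expr0n/=; nra.
have [x3|x3] := leP x 3.
  rewrite (pos_nonneg (ltW x0)) (@pos_nonneg (x - 1)); last by lra.
  rewrite (@pos_nonneg (x - 2)); last by lra.
  rewrite !pos_nonpos; try lra.
  (* with t = x - 2 the value is (3 t (1 - t)^2 + 4 - 3 t) / 6 *)
  have : 0 <= (x - 2) * (x - 3) ^+ 2 by rewrite mulr_ge0 ?sqr_ge0//; lra.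
  rewrite ?expr0n/=; nra.
have [x4|x4] := leP x 4.
  rewrite (pos_nonneg (ltW x0)) (@pos_nonneg (x - 1)); last by lra.
  rewrite (@pos_nonneg (x - 2)) ?(@pos_nonneg (x - 3)); try lra.
  rewrite !pos_nonpos; try lra.
  have := cube_ge0 (4 - x) ltac:(lra).
  rewrite ?expr0n/=; nra.
by rewrite !pos_nonneg; try lra; nra.
Qed.

Lemma step_increment_supp x : step x - step (x - 1) != 0 -> 0 <= x <= 4.
Proof.
move=> h; apply/andP; split; rewrite leNgt; apply/negP => xlt; move/eqP: h; apply.
  by rewrite !step_le0 ?subrr//; lra.
by rewrite !step_ge3 ?subrr//; lra.
Qed.

Lemma taylor2_affine (K c b : R) g g1 g2 : 0 <= K -> taylor2 K g g1 g2 ->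
  taylor2 (K * (c ^+ 2 + `|c| ^+ 3)) (fun x => g (c * x + b))
    (fun x => g1 (c * x + b) * c) (fun x => g2 (c * x + b) * c ^+ 2).
Proof.
move=> K0 [bg bg1 bg2 tg].
have maff : measurable_fun setT (fun x : R => c * x + b).
  by apply: measurable_funD => //; exact: measurable_funM.
have aff (f : R -> R) (k : R) : bmeas f -> bmeas (fun x => f (c * x + b) * k).
  move=> [mf [M fM]]; split.
    by apply: measurable_funM => //; exact: measurableT_comp.
  by exists (M * `|k|) => x; rewrite normrM ler_wpM2r.
split; try exact: aff.
  by have := aff _ 1 bg; under eq_fun do rewrite mulr1.
move=> x h; apply: (@le_trans _ _
    (K * Num.min ((c * h) ^+ 2) (`|c * h| ^+ 3))).
  apply: le_trans (tg (c * x + b) (c * h)).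
  rewrite (_ : c * x + b + c * h = c * (x + h) + b); last by ring.
  by rewrite le_eqVlt; apply/orP; left; apply/eqP; congr (`| _ |); ring.
rewrite -mulrA ler_wpM2l// normrM !exprMn ge_min.
have [hh|hh] := leP (h ^+ 2) (`|h| ^+ 3); apply/orP; [left|right].
  by rewrite ler_wpM2r ?sqr_ge0// lerDl exprn_ge0.
by rewrite ler_wpM2r ?exprn_ge0// lerDr sqr_ge0.
Qed.

(** Heine's theorem on [-M, M], with the second point unrestricted. *)
Lemma continuous_unif_segment (f : R -> R) (M e : R) : continuous f -> 0 < e ->
  exists2 r : R, 0 < r & forall x y, `|x| <= M -> `|x - y| <= r ->
    `|f x - f y| <= e.
Proof.
move=> cf e0; have /compact_near_coveringP cM := @segment_compact R (- M) M.
have e20 : 0 < e / 2 by rewrite divr_gt0.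
have : \forall r \near (0 : R)^'+, forall x, `[- M, M]%classic x ->
    forall y, `|x - y| <= r -> `|f x - f y| <= e.
  apply: (cM _ (0 : R)^'+ (fun r x => forall y, `|x - y| <= r -> `|f x - f y| <= e)).
  move=> x _.
  have /cvgrPdist_le/(_ _ e20) /nbhs_ballP[q /= q0 qf] := cf x.
  have q20 : 0 < q / 2 by rewrite divr_gt0.
  exists (ball x (q / 2), [set r | r < q / 2]) => /=.
    split; first by exists (q / 2).
    by exists (q / 2) => //= z /=; rewrite sub0r normrN => + z0; rewrite gtr0_norm.
  move=> [z r] /= [xz rq] y zy.
  have fz : `|f x - f z| <= e / 2.
    by apply: qf; rewrite /ball/= (lt_le_trans xz)//; lra.
  have fy : `|f x - f y| <= e / 2.
    apply: qf; rewrite /ball /= [ltRHS](splitr q) (_ : x - y = (x - z) + (z - y)); last by ring.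
    by rewrite (le_lt_trans (ler_normD _ _))// ltrD// (le_lt_trans zy).
  rewrite (_ : f z - f y = (f x - f y) - (f x - f z)); last by ring.
  by rewrite (le_trans (ler_normB _ _))// [leRHS](splitr e) lerD.
move=> [r /= r0 rP]; exists (r / 2); first by rewrite divr_gt0.
move=> x y xM xy; apply: (rP (r / 2)) => //=.
- by rewrite sub0r normrN gtr0_norm ?divr_gt0//; lra.
- by rewrite divr_gt0.
- by rewrite in_itv/= -ler_norml.
Qed.

Definition spline_interp (f : nat -> R) (c b : R) (n : nat) (x : R) :=
  \sum_(k < n) f k * (step (c * x + (b - k%:R)) - step (c * x + (b - k.+1%:R))).

(** The increments of translated steps form a partition of unity by telescoping. *)
Lemma step_increments_sum (c b : R) (n : nat) x :
  \sum_(k < n) (step (c * x + (b - k%:R)) - step (c * x + (b - k.+1%:R))) =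
  step (c * x + b) - step (c * x + (b - n%:R)).
Proof.
elim: n => [|n IH]; first by rewrite big_ord0 subr0 subrr.
by rewrite big_ord_recr/= IH; ring.
Qed.

(** At a point [x] of the segment the spline is a mean of values of [f] at nodes
    whose distance to [x] does not exceed the range of uniform continuity that
    corresponds to [e]. *)
Lemma spline_approx (f : R -> R) (C M e : R) : continuous f ->
  bounded_by C f -> 0 <= M -> 0 < e ->
  exists a c b n, let F := spline_interp a c b n in
    (forall x, `|x| <= M -> `|f x - F x| <= e) /\ bounded_by (72 * C) F.
Proof.
move=> cf fC M0 e0; have [r r0 rP] := continuous_unif_segment M cf e0.
(* The mesh is r / 4 because a B-spline spreads over four cells; the offset 3
   makes the first step complete at - M. *)
pose c := 4 / r; pose b := c * M + 3.
have c0 : 0 < c by rewrite divr_gt0.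
pose n := (Num.truncn (2 * (c * M) + 3)).+1.
have n_gt : 2 * (c * M) + 3 < n%:R by exact: truncnS_gt.
pose a (k : nat) := f ((k%:R - b) / c).
have incr0 k x : 0 <= step (c * x + (b - k%:R)) - step (c * x + (b - k.+1%:R)).
  rewrite (_ : c * x + (b - k.+1%:R) = c * x + (b - k%:R) - 1).
    exact: step_increment_ge0.
  by rewrite -(natr1 k); ring.
exists a, c, b, n; split.
  move=> x xM.
  have xM2 : - (c * M) <= c * x <= c * M.
    by rewrite -mulrN !ler_pM2l// -ler_norml.
  have E1 : \sum_(k < n) (step (c * x + (b - k%:R)) - step (c * x + (b - k.+1%:R))) = 1.
    rewrite step_increments_sum step_ge3; last by rewrite /b; lra.
    by rewrite step_le0 ?subr0// /b; lra.
  have Ez (z : R) : z = \sum_(k < n) z *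
      (step (c * x + (b - k%:R)) - step (c * x + (b - k.+1%:R))).
    by rewrite -mulr_sumr E1 mulr1.
  rewrite [X in `|X - _|]Ez /spline_interp -sumrB.
  apply: (le_trans (ler_norm_sum _ _ _)); rewrite [leRHS]Ez.
  apply: ler_sum => k _; rewrite -mulrBl normrM (ger0_norm (incr0 _ _)).
  have [->|nz] := eqVneq (step (c * x + (b - k%:R)) - step (c * x + (b - k.+1%:R))) 0.
    by rewrite !mulr0.
  apply: ler_wpM2r => //; apply: rP => //.
  have : 0 <= c * x + (b - k%:R) <= 4.
    apply: step_increment_supp; move: nz; congr (_ - step _ != 0).
    by rewrite -(natr1 k); ring.
  have -> : x - (k%:R - b) / c = (c * x + (b - k%:R)) / c.
    by field; rewrite gt_eqF.
  move=> /andP[h0 h4]; rewrite ger0_norm; last exact: divr_ge0 h0 (ltW c0).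
  rewrite ler_pdivrMr//; have -> : r * c = 4 by rewrite /c; field; rewrite gt_eqF.
  by [].
move=> x; rewrite (le_trans (ler_norm_sum _ _ _))//.
have C0 : 0 <= C by exact: le_trans (normr_ge0 _) (fC 0).
apply: (@le_trans _ _ (\sum_(k < n) C *
   (step (c * x + (b - k%:R)) - step (c * x + (b - k.+1%:R))))).
  apply: ler_sum => k _; rewrite normrM (ger0_norm (incr0 _ _)).
  by apply: ler_wpM2r; [exact: incr0|exact: fC].
rewrite -mulr_sumr step_increments_sum mulrC ler_wpM2r//.
rewrite (le_trans (ler_norm _))// (le_trans (ler_normB _ _))//.
have [h1 _ _] := step_bounds (c * x + b).
by have [h2 _ _] := step_bounds (c * x + (b - n%:R)); lra.
Qed.

End step.

(** * From smooth steps to bounded continuous functions *)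

Section weak_cvg.
Context {R : realType}.
Implicit Types (mu nu : probability R R).

Lemma bmeas_step_affine (c b : R) : bmeas (fun x => step (c * x + b)).
Proof.
split; last first.
  by exists 36 => x; case: (step_bounds (c * x + b)).
apply: (measurableT_comp measurable_step).
by apply: measurable_funD => //; exact: measurable_funM.
Qed.

Lemma bmeas_spline_interp (a : nat -> R) (c b : R) n :
  bmeas (spline_interp a c b n).
Proof.
elim: n => [|n IH].
  rewrite (_ : spline_interp _ _ _ _ = cst 0).
    by split => //; exists 0 => x; rewrite normr0.
  by apply/funext => x; rewrite /spline_interp big_ord0.
rewrite (_ : spline_interp _ _ _ _ = (fun x => spline_interp a c b n x +
  a n * (step (c * x + (b - n%:R)) - step (c * x + (b - n.+1%:R))))).
  by apply: bmeasD => //; apply/bmeasZ/bmeasB; exact: bmeas_step_affine.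
by apply/funext => x; rewrite /spline_interp big_ord_recr.
Qed.

Variables (lam : nat -> probability R R) (nu : probability R R) (V : R).
Hypothesis lam_steps : forall c b : R,
  \int[lam n]_x step (c * x + b) @[n --> \oo] --> \int[nu]_x step (c * x + b).

Lemma cvg_spline_interp (a : nat -> R) (c b : R) m :
  \int[lam n]_x spline_interp a c b m x @[n --> \oo] -->
  \int[nu]_x spline_interp a c b m x.
Proof.
elim: m => [|m IH].
  have E mu : \int[mu]_x spline_interp a c b 0 x = 0.
    rewrite -[RHS](Rintegral_prob_cst mu); apply: eq_Rintegral => x _.
    by rewrite /spline_interp big_ord0.
  by under eq_fun do rewrite E; rewrite E; exact: cvg_cst.
have E mu : \int[mu]_x spline_interp a c b m.+1 x =
    \int[mu]_x spline_interp a c b m x +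
    a m * (\int[mu]_x step (c * x + (b - m%:R)) -
           \int[mu]_x step (c * x + (b - m.+1%:R))).
  have I1 := bmeas_integrable mu (bmeas_step_affine c (b - m%:R)).
  have I2 := bmeas_integrable mu (bmeas_step_affine c (b - m.+1%:R)).
  have I3 := bmeas_integrable mu (bmeas_spline_interp a c b m).
  have I4 := integrableB measurableT I1 I2.
  rewrite -RintegralB// -RintegralZl// -RintegralD//.
    by apply: eq_Rintegral => x _; rewrite /spline_interp big_ord_recr.
  exact: (integrableZl measurableT (a m) I4).
under eq_fun do rewrite E; rewrite E.
apply: cvgD; first exact: IH.
by apply: cvgM; [exact: cvg_cst|apply: cvgB; exact: lam_steps].
Qed.

Hypothesis lam2 : forall n,
  (lam n).-integrable setT (EFin \o (fun x => x ^+ 2)) /\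
  \int[lam n]_x (x ^+ 2) <= V.
Hypothesis nu2 : nu.-integrable setT (EFin \o (fun x => x ^+ 2)) /\
  \int[nu]_x (x ^+ 2) <= V.

(** Uniformly bounded second moments provide the tightness that reduces
    bounded continuous functions to their restrictions to a segment. *)
Theorem weak_cvg_of_steps (f : R -> R) : continuous f ->
  (exists C, bounded_by C f) ->
  \int[lam n]_x f x @[n --> \oo] --> \int[nu]_x f x.
Proof.
move=> cf [C fC].
have C0 : 0 <= C by exact: le_trans (normr_ge0 _) (fC 0).
have bf : bmeas f by split; [exact: continuous_measurable_fun|exists C].
have V0 : 0 <= V.
  by apply: le_trans nu2.2; apply: Rintegral_ge0 => x _; exact: sqr_ge0.
apply/cvgrPdist_le => e e0.
(* M is such that the tail 73 * C * V / M ^+ 2 is at most e1; 73 * C bounds the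
   distance from f to its spline everywhere. *)
pose e1 := e / 8; have e10 : 0 < e1 by rewrite divr_gt0.
pose M := 1 + 73 * C * V / e1.
have M1 : 1 <= M by rewrite lerDl divr_ge0 ?mulr_ge0// ltW.
have M0 : 0 < M by exact: lt_le_trans M1.
have [a [c [b [m [Fe FC]]]]] := spline_approx cf fC (ltW M0) e10.
set F := spline_interp a c b m in Fe FC *.
have bF : bmeas F by exact: bmeas_spline_interp.
have tail mu : mu.-integrable setT (EFin \o (fun x => x ^+ 2)) /\
    \int[mu]_x (x ^+ 2) <= V ->
    `|\int[mu]_x f x - \int[mu]_x F x| <= 2 * e1.
  move=> [i2 muV].
  have If := bmeas_integrable mu bf; have IF := bmeas_integrable mu bF.
  have IB := integrableB measurableT If IF.
  rewrite -RintegralB//; apply: (le_trans (le_normr_Rintegral measurableT IB)).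
  have I0 := finite_measure_integrable_cst mu e1 (@measurableT _ R).
  have I1 := integrableZl measurableT (73 * C / M ^+ 2) i2.
  apply: (@le_trans _ _ (\int[mu]_x (e1 + 73 * C / M ^+ 2 * x ^+ 2))).
    apply: le_Rintegral => //.
    - exact: (integrable_norm IB).
    - exact: (integrableD measurableT I0 I1).
    - move=> x _; have [xM|xM] := leP `|x| M.
        rewrite (le_trans (Fe x xM))// lerDl mulr_ge0 ?sqr_ge0//.
        by rewrite divr_ge0 ?sqr_ge0// mulr_ge0.
      rewrite (le_trans (ler_normB _ _))// (le_trans (lerD (fC x) (FC x)))//.
      rewrite (_ : C + 72 * C = 73 * C); last by ring.
      rewrite -[leLHS]add0r; apply: lerD; first exact: ltW.
      rewrite mulrAC ler_pdivlMr ?exprn_gt0// ler_wpM2l ?mulr_ge0//.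
      by rewrite -(real_normK (num_real x)) ler_pXn2r ?nnegrE ?(ltW M0) ?(ltW xM).
  rewrite RintegralD// Rintegral_prob_cst RintegralZl//.
  rewrite (_ : 2 * e1 = e1 + e1); last by ring.
  rewrite lerD2l (le_trans (ler_wpM2l _ muV))//.
    by rewrite divr_ge0 ?sqr_ge0// mulr_ge0.
  rewrite mulrAC ler_pdivrMr ?exprn_gt0//.
  apply: (@le_trans _ _ (e1 * M)).
    have -> : e1 * M = e1 + 73 * C * V by rewrite /M; field; rewrite gt_eqF.
    by rewrite lerDr ltW.
  by rewrite ler_pM2l// expr2 ler_peMl// ltW.
have /cvgrPdist_le/(_ (e / 2)) := @cvg_spline_interp a c b m.
have e20 : 0 < e / 2 by rewrite divr_gt0.
move=> /(_ e20); apply: filterS => n hn.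
have t1 := tail nu nu2; have t2 := tail (lam n) (lam2 n).
rewrite (_ : _ - _ = (\int[nu]_x f x - \int[nu]_x F x) +
  (\int[nu]_x F x - \int[lam n]_x F x) -
  (\int[lam n]_x f x - \int[lam n]_x F x)); last by ring.
rewrite (le_trans (ler_normB _ _))//.
apply: (le_trans (lerD (ler_normD _ _) (lexx _))).
apply: (le_trans (lerD (lerD t1 hn) t2)).
by rewrite /e1; lra.
Qed.

End weak_cvg.

(** * Variables independent of a past *)

Section innovations.
Context {d : measure_display} {T : measurableType d} {R : realType}.
Variable P : probability T R.
Implicit Types (G : set (set T)) (X Y Z : T -> R) (mu : probability R R).

Definition adapted G X := measurable_fun [set: g_sigma_algebraType G] X.

Definition indep_with_law G Z mu := forall A B, <<s G >> A -> measurable B ->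
  P (A `&` Z @^-1` B) = (P A * mu B)%E.

Lemma adapted_measurable G X : G `<=` measurable -> adapted G X ->
  measurable_fun setT X.
Proof.
move=> Gm aX _ A mA.
by apply: (smallest_sub (@sigma_algebra_measurable _ T) Gm); exact: aX.
Qed.

Lemma adaptedD G X Y : adapted G X -> adapted G Y ->
  adapted G (fun w => X w + Y w).
Proof. exact: measurable_funD. Qed.

(** Bundles a measurable function, so that it has a [distribution]. *)
Definition rv X (mX : measurable_fun setT X) : {mfun T >-> R} :=
  mfun_Sub (mem_set mX).

Lemma law_of_indep G Z mu (mZ : measurable_fun setT Z) A :
  indep_with_law G Z mu -> measurable A -> distribution P (rv mZ) A = mu A.
Proof.
move=> iZ mA; have := iZ setT A (@measurableT _ (g_sigma_algebraType G)) mA.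
by rewrite setTI probability_setT mul1e.
Qed.

(** Fubini's theorem for the joint law of [X] and [Z], which is a product. *)
Lemma indep_integral G X Z mu (mX : measurable_fun setT X) (h : R * R -> R) :
  G `<=` measurable -> adapted G X -> measurable_fun setT Z ->
  indep_with_law G Z mu -> measurable_fun setT h ->
  P.-integrable setT (fun w => (h (X w, Z w))%:E) ->
  (\int[P]_w (h (X w, Z w))%:E =
   \int[distribution P (rv mX)]_x \int[mu]_z (h (x, z))%:E)%E.
Proof.
move=> Gm aX mZ iZ mh ih.
pose XZ w := (X w, Z w).
have mXZ : measurable_fun setT XZ by exact: measurable_fun_pair.
pose XZm : {mfun T >-> (R * R)%type} := mfun_Sub (mem_set mXZ).
have mhE : measurable_fun setT (EFin \o h) by exact/measurable_EFinP.
have joint A : measurable A ->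
    (distribution P (rv mX) \x mu)%E A = distribution P XZm A.
  move=> mA; apply: product_measure_unique => // B C mB mC.
  by apply: iZ => //; rewrite -[X in <<s _ >> X]setTI; exact: aX.
have ihXZ : (distribution P XZm).-integrable setT (EFin \o h).
  exact: integrable_pushforward.
have E : (\int[P]_w (h (X w, Z w))%:E =
    \int[distribution P XZm]_p (h p)%:E)%E.
  by rewrite integral_distribution.
have ihprod : (distribution P (rv mX) \x mu)%E.-integrable setT (EFin \o h).
  apply/integrableP; split => //.
  rewrite (eq_measure_integral (distribution P XZm)); last first.
    by move=> A mA _; exact: joint.
  by case/integrableP : ihXZ.
rewrite E (integral12_prod_meas1 ihprod).
by apply: eq_measure_integral => A mA _; exact/esym/joint.
Qed.

Lemma indep_Rintegral_bounded G X Z mu (h : R * R -> R) :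
  G `<=` measurable -> adapted G X -> measurable_fun setT Z ->
  indep_with_law G Z mu -> bmeas h ->
  \int[P]_w h (X w, Z w) = \int[P]_w \int[mu]_z h (X w, z).
Proof.
move=> Gm aX mZ iZ bh; have mX := adapted_measurable Gm aX.
have [mh [M hM]] := bh.
have mXZ : measurable_fun setT (fun w => (X w, Z w)).
  exact: measurable_fun_pair.
have bhx x : bmeas (fun z => h (x, z)).
  by split; [exact: measurable_fun_pair2|exists M => z].
rewrite [LHS]/Rintegral (indep_integral mX Gm aX mZ iZ mh); last first.
  apply: bmeas_integrable; split; first exact: measurableT_comp.
  by exists M => w.
have Efin x : (\int[mu]_z (h (x, z))%:E)%E = (\int[mu]_z h (x, z))%:E.
  rewrite fineK//; apply: (integrable_fin_num measurableT).
  exact: bmeas_integrable.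
have bF : bmeas (fun x => \int[mu]_z h (x, z)).
  split; last by exists M => x; apply: bounded_Rintegral; [case: (bhx x)|].
  have /measurable_fubini_F := bmeas_integrable (mu \x mu)%E bh.
  by move=> mF; apply: measurableT_comp; last exact: mF.
have [mF [N FN]] := bF.
have mFE : measurable_fun setT (fun x => (\int[mu]_z h (x, z))%:E).
  exact/measurable_EFinP.
have iF : P.-integrable setT ((fun x => (\int[mu]_z h (x, z))%:E) \o rv mX).
  apply: (@bmeas_integrable _ _ _ P (fun w => \int[mu]_z h (X w, z))).
  by split; [exact: (measurableT_comp mF)|exists N => w].
transitivity (fine (\int[distribution P (rv mX)]_x (\int[mu]_z h (x, z))%:E)%E).
  by congr fine; apply: eq_integral => x _; exact: Efin.
by rewrite (integral_distribution mFE iF).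
Qed.

End innovations.

(** * Sums of centred variables, each independent of its past *)

Section partial_sums.
Context {d : measure_display} {T : measurableType d} {R : realType}.
Variable P : probability T R.
Variables (gen : nat -> set (set T)) (Z : nat -> T -> R) (mu : probability R R).
Variable v : R.
Hypothesis gen_measurable : forall n, gen n `<=` measurable.
Hypothesis Z_adapted : forall i n, (i < n)%N -> adapted (gen n) (Z i).
Hypothesis Z_indep : forall n, indep_with_law P (gen n) (Z n) mu.
Hypothesis mu_var : centered_var mu v.

Definition psum m n w := \sum_(m <= i < n) Z i w.

Lemma psumnn m w : psum m m w = 0. Proof. by rewrite /psum big_geq. Qed.

Lemma psumSr m n w : (m <= n)%N -> psum m n.+1 w = psum m n w + Z n w.
Proof. by move=> mn; rewrite /psum big_nat_recr. Qed.

Lemma psum_split m n w : (m <= n)%N -> psum 0 n w = psum 0 m w + psum m n w.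
Proof. by move=> mn; rewrite /psum (@big_cat_nat _ _ _ m). Qed.

Lemma psum_adapted m n k : (n <= k)%N -> adapted (gen k) (psum m n).
Proof.
move=> nk; have [mn|nm] := leqP m n; last first.
  rewrite (_ : psum m n = cst 0); first exact: measurable_cst.
  by apply/funext => w; rewrite /psum big_geq// ltnW.
elim: n mn nk => [|n IH] mn nk.
  rewrite (_ : psum m 0 = cst 0); first exact: measurable_cst.
  by apply/funext => w; rewrite /psum big_geq.
move: mn; rewrite leq_eqVlt => /orP[/eqP <-|mn].
  rewrite (_ : psum m m = cst 0); first exact: measurable_cst.
  by apply/funext => w; rewrite psumnn.
rewrite (_ : psum m n.+1 = (fun w => psum m n w + Z n w)).
  by apply: adaptedD; [apply: IH => //; exact: ltnW|exact: Z_adapted].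
by apply/funext => w; rewrite psumSr.
Qed.

Lemma measurable_Z n : measurable_fun setT (Z n).
Proof. exact: adapted_measurable (@gen_measurable n.+1) (Z_adapted (ltnSn n)). Qed.

Lemma measurable_psum m n : measurable_fun setT (psum m n).
Proof. exact: adapted_measurable (@gen_measurable n) (psum_adapted m (leqnn n)). Qed.

Lemma Z_transfer n (f : R -> R) : measurable_fun setT f ->
  mu.-integrable setT (EFin \o f) ->
  P.-integrable setT (fun w => (f (Z n w))%:E) /\
  \int[P]_w f (Z n w) = \int[mu]_z f z.
Proof.
move=> mf iF; have mZ := measurable_Z n.
have mfE : measurable_fun setT (EFin \o f) by exact/measurable_EFinP.
have law A : measurable A -> distribution P (rv mZ) A = mu A.
  exact: (law_of_indep mZ (@Z_indep n)).
have iP : P.-integrable setT ((EFin \o f) \o rv mZ).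
  apply/integrableP; split; first exact: measurableT_comp.
  have mabs : measurable_fun setT (fun y => `|(f y)%:E|)%E.
    exact: measurableT_comp.
  have := ge0_integral_distribution (P := P) (rv mZ) mabs
    (fun y => abse_ge0 (f y)%:E).
  rewrite (eq_measure_integral mu) => [E|A mA _]; last exact: law.
  rewrite [X in (X < _)%E](_ : _ = \int[mu]_x `|(f x)%:E|)%E; last exact: esym E.
  by case/integrableP : iF.
split; first exact: iP.
congr fine.
rewrite [LHS](_ : _ = \int[distribution P (rv mZ)]_y (f y)%:E)%E; last first.
  by rewrite (integral_distribution mfE iP).
by apply: eq_measure_integral => A mA _; exact: law.
Qed.

Lemma Z_sqr n : P.-integrable setT (fun w => (Z n w ^+ 2)%:E) /\
  \int[P]_w (Z n w ^+ 2) = v.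
Proof.
have [_ _ i2 <-] := mu_var; apply: (@Z_transfer n (fun z => z ^+ 2)) => //.
Qed.

Lemma Z_mean n : P.-integrable setT (fun w => (Z n w)%:E) /\
  \int[P]_w Z n w = 0.
Proof. by have [i1 <- _ _] := mu_var; apply: (@Z_transfer n id). Qed.

Lemma psum_mean n : P.-integrable setT (fun w => (psum 0 n w)%:E) /\
  \int[P]_w psum 0 n w = 0.
Proof.
elim: n => [|n [iS ES]].
  split; first by under eq_fun do rewrite psumnn; exact: finite_measure_integrable_cst.
  by under eq_Rintegral do rewrite psumnn; rewrite Rintegral_prob_cst.
have [iZ EZ] := Z_mean n.
split; first by under eq_fun do rewrite psumSr//; exact: (integrableD measurableT iS iZ).
by under eq_Rintegral do rewrite psumSr//; rewrite RintegralD// ES EZ addr0.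
Qed.

Lemma integrable_mul_sqr (X Y : T -> R) :
  measurable_fun setT X -> measurable_fun setT Y ->
  P.-integrable setT (fun w => (X w ^+ 2)%:E) ->
  P.-integrable setT (fun w => (Y w ^+ 2)%:E) ->
  P.-integrable setT (fun w => (X w * Y w)%:E).
Proof.
move=> mX mY iX iY; apply: (le_integrable measurableT _ _
  (integrableD measurableT iX iY)).
  by apply/measurable_EFinP; exact: measurable_funM.
move=> w _ /=; rewrite lee_fin [leRHS]ger0_norm ?addr_ge0 ?sqr_ge0//.
by rewrite ler_norml; apply/andP; split; nra.
Qed.

(** The summands are orthogonal: by Fubini's theorem the cross term is an
    expectation of multiples of the mean of [mu]. *)
Lemma psum_sqr m j : P.-integrable setT (fun w => (psum m (m + j) w ^+ 2)%:E) /\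
  \int[P]_w (psum m (m + j) w ^+ 2) = j%:R * v.
Proof.
elim: j => [|j [iS ES]].
  rewrite addn0 mul0r.
  have E0 w : psum m m w ^+ 2 = 0 by rewrite psumnn expr0n.
  split.
    under eq_fun do rewrite E0.
    exact: (finite_measure_integrable_cst P 0).
  by rewrite -[RHS](Rintegral_prob_cst P); apply: eq_Rintegral => w _.
set n := (m + j)%N in iS ES *.
have [iZ EZ] := Z_sqr n.
have mS := measurable_psum m n; have mZ := measurable_Z n.
have iSZ := integrable_mul_sqr mS mZ iS iZ.
have E w : psum m (m + j.+1) w ^+ 2 =
    psum m n w ^+ 2 + 2 * (psum m n w * Z n w) + Z n w ^+ 2.
  by rewrite addnS psumSr ?leq_addr// -/n; ring.
have ESZ : \int[P]_w (psum m n w * Z n w) = 0.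
  have mh : measurable_fun setT (fun p : R * R => p.1 * p.2).
    exact: measurable_funM.
  have := indep_integral mS (@gen_measurable n) (psum_adapted m (leqnn n)) mZ
    (@Z_indep n) mh iSZ => /= EI.
  rewrite /Rintegral EI.
  rewrite (_ : (fun x => _) = cst 0%E) ?integral0//.
  apply/funext => x; have [i1 m1 _ _] := mu_var.
  rewrite -[LHS]fineK; last first.
    apply: (integrable_fin_num measurableT).
    exact: (integrableZl measurableT x i1).
  by have := RintegralZl x measurableT i1; rewrite m1 mulr0 /Rintegral => ->.
have I2 := integrableZl measurableT 2 iSZ.
have I12 := integrableD measurableT iS I2.
have I123 := integrableD measurableT I12 iZ.
split; first by under eq_fun do rewrite E; exact: I123.
under eq_Rintegral do rewrite E.
by rewrite RintegralD// RintegralD// RintegralZl// ESZ EZ ES mulr0 addr0 -natr1; ring.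
Qed.

(** Conditioning on the past turns one summand into one application of
    [conv mu c]. *)
Lemma psum_iter_conv (c : R) n g : bmeas g ->
  \int[P]_w g (c * psum 0 n w) = iter n (conv mu c) g 0.
Proof.
elim: n g => [|n IH] g bg.
  rewrite /= -[RHS](Rintegral_prob_cst P); apply: eq_Rintegral => w _.
  by rewrite psumnn mulr0.
rewrite iterSr -IH; last exact: bmeas_conv.
have [mg [M gM]] := bg.
pose h (p : R * R) := g (c * p.1 + c * p.2).
have bh : bmeas h.
  split; last by exists M => p; exact: gM.
  apply: (measurableT_comp mg).
  by apply: measurable_funD; apply: measurable_funM.
rewrite -(indep_Rintegral_bounded (@gen_measurable n)
  (psum_adapted 0 (leqnn n)) (measurable_Z n) (@Z_indep n) bh).
by apply: eq_Rintegral => w _; rewrite /h/= psumSr// mulrDr.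
Qed.

End partial_sums.

(** * The strong law of large numbers under a second moment *)

Section slln.
Context {d : measure_display} {T : measurableType d} {R : realType}.
Variable P : probability T R.

(** Nonnegative variables with summable expectations tend to zero almost
    surely, since their sum is integrable, hence almost surely finite. *)
Lemma ae_cvg0_of_summable (W : nat -> T -> R) (a : nat -> R) :
  (forall k, measurable_fun setT (W k)) -> (forall k w, 0 <= W k w) ->
  (forall k, (\int[P]_w (W k w)%:E <= (a k)%:E)%E) ->
  (\sum_(k <oo) (a k)%:E < +oo)%E ->
  {ae P, forall w, W k w @[k --> \oo] --> (0 : R)}.
Proof.
move=> mW W0 Wa suma.
have mWE k : measurable_fun setT (fun w => (W k w)%:E) by exact/measurable_EFinP.
pose S w := (\sum_(k <oo) (W k w)%:E)%E.
have S0 w : (0 <= S w)%E by apply: nneseries_ge0 => k _ _; rewrite lee_fin.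
have iS : P.-integrable setT S.
  apply/integrableP; split.
    by apply: ge0_emeasurable_sum => // k w _ _; rewrite lee_fin.
  under eq_integral => w _ do rewrite gee0_abs//.
  rewrite integral_nneseries//; last by move=> k w _; rewrite lee_fin.
  apply: le_lt_trans suma; apply: lee_nneseries => k _; last exact: Wa.
  by move=> _; apply: integral_ge0 => w _; rewrite lee_fin.
have := integrable_ae measurableT iS; apply: filterS => w /(_ I) Sfin.
have tail0 : (\sum_(n <= k <oo) (W k w)%:E)%E @[n --> \oo] --> 0%E.
  apply: nneseries_tail_cvg; first by rewrite -ge0_fin_numE// S0.
  by move=> k; rewrite lee_fin.
have : (W n w)%:E @[n --> \oo] --> 0%E.
  apply: (squeeze_cvge _ (cvg_cst 0%E) tail0).
  apply: nearW => n; rewrite lee_fin W0/=.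
  have := @nneseries_lim_ge R (fun k => (W k w)%:E) xpredT n n.+1.
  by rewrite big_nat1; apply => k _ _; rewrite lee_fin.
by move/fine_cvg.
Qed.

(** By comparison with the telescoping series of [1 / n.+1 - 1 / n.+2]. *)
Lemma sum_inv_sqr_lty (C : R) : 0 <= C ->
  (\sum_(k <oo) (C / k.+1%:R ^+ 2)%:E < +oo)%E.
Proof.
move=> C0.
have bound n : \sum_(0 <= k < n) (C / k.+1%:R ^+ 2) <= 2 * C * (1 - n.+1%:R^-1).
  elim: n => [|n IH]; first by rewrite big_geq// invr1 subrr mulr0.
  rewrite big_nat_recr//=.
  apply: (le_trans (lerD IH (lexx _))).
  have : 1 <= n.+1%:R :> R by rewrite ler1n.
  rewrite -(natr1 n.+1); move: (n.+1%:R) => x x1.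
  have x0 : x != 0 by rewrite gt_eqF// (lt_le_trans _ x1).
  have x10 : x + 1 != 0 by rewrite gt_eqF// addr_gt0// (lt_le_trans _ x1).
  rewrite -subr_ge0.
  rewrite (_ : _ - _ = C * ((x - 1) / (x ^+ 2 * (x + 1)))); last first.
    by field; rewrite x0 x10.
  rewrite mulr_ge0// divr_ge0 ?subr_ge0// mulr_ge0 ?sqr_ge0// addr_ge0//.
  exact: le_trans x1.
apply: (@le_lt_trans _ _ (2 * C)%:E); last exact: ltry.
apply: lime_le.
  by apply: is_cvg_nneseries => k _ _; rewrite lee_fin divr_ge0// sqr_ge0.
apply: nearW => n; rewrite sumEFin lee_fin (le_trans (bound n))//.
by rewrite ler_piMr ?mulr_ge0// gerBl invr_ge0.
Qed.

Variables (gen : nat -> set (set T)) (Z : nat -> T -> R) (mu : probability R R).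
Variable v : R.
Hypothesis gen_measurable : forall n, gen n `<=` measurable.
Hypothesis Z_adapted : forall i n, (i < n)%N -> adapted (gen n) (Z i).
Hypothesis Z_indep : forall n, indep_with_law P (gen n) (Z n) mu.
Hypothesis mu_var : centered_var mu v.

Let v0 : 0 <= v.
Proof. by case: mu_var => _ _ _ <-; apply: Rintegral_ge0 => z _; exact: sqr_ge0. Qed.

(** Control of the whole block [(k+1)^2 <= n < (k+2)^2], normalized by its
    left end. *)
Let block k w : R :=
  (psum Z 0 (k.+1 ^ 2) w / (k.+1 ^ 2)%:R) ^+ 2 +
  \sum_(j < (2 * k.+1).+1)
    (psum Z (k.+1 ^ 2) (k.+1 ^ 2 + j) w / (k.+1 ^ 2)%:R) ^+ 2.

Let measurable_block k : measurable_fun setT (block k).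
Proof.
have mS m n : measurable_fun setT (psum Z m n).
  exact: measurable_psum gen_measurable Z_adapted _ _.
apply: measurable_funD.
  by apply: measurable_funX; apply: measurable_funM.
apply: measurable_sum => j.
by apply: measurable_funX; apply: measurable_funM.
Qed.

Let block_ge0 k w : 0 <= block k w.
Proof. by rewrite addr_ge0 ?sqr_ge0// sumr_ge0// => j _; exact: sqr_ge0. Qed.

(* The first term contributes v / (k+1)^2 and each of the 2 k + 3 others at most
   2 (k+1) v / (k+1)^4, whence a summable bound. *)
Let integral_block k :
  (\int[P]_w (block k w)%:E <= (7 * v / k.+1%:R ^+ 2)%:E)%E.
Proof.
set m := (k.+1 ^ 2)%N.
have mS m1 n1 : measurable_fun setT (psum Z m1 n1).
  exact: measurable_psum gen_measurable Z_adapted _ _.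
have m2 : m%:R = k.+1%:R ^+ 2 :> R by rewrite natrX.
have m0 : 0 < m%:R :> R by rewrite m2 exprn_gt0// ltr0n.
have term n1 j : (\int[P]_w ((psum Z n1 (n1 + j) w / m%:R) ^+ 2)%:E =
    (j%:R * v / m%:R ^+ 2)%:E)%E.
  have [iS ES] := psum_sqr gen_measurable Z_adapted Z_indep mu_var n1 j.
  have fin := integrable_fin_num measurableT iS.
  under eq_integral => w _ do rewrite exprMn EFinM.
  rewrite ge0_integralZr//.
  - by rewrite -ES -exprVn [RHS]EFinM; congr (_ * _)%E; rewrite /Rintegral fineK.
  - by apply/measurable_EFinP; exact: measurable_funX.
  - by move=> w _; rewrite lee_fin sqr_ge0.
under eq_integral => w _ do rewrite EFinD -sumEFin.
rewrite ge0_integralD//; last 4 first.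
- by move=> w _; rewrite lee_fin sqr_ge0.
- apply/measurable_EFinP; apply: measurable_funX; exact: measurable_funM.
- by move=> w _; apply: sume_ge0 => j _; rewrite lee_fin sqr_ge0.
- apply: emeasurable_sum => j; apply/measurable_EFinP; apply: measurable_funX.
  exact: measurable_funM.
rewrite ge0_integral_sum//; last 2 first.
- move=> j; apply/measurable_EFinP; apply: measurable_funX.
  exact: measurable_funM.
- by move=> j w _; rewrite lee_fin sqr_ge0.
have term0 := term 0%N m; rewrite add0n in term0.
rewrite -/m term0.
under eq_bigr do rewrite term.
rewrite sumEFin -EFinD lee_fin.
apply: (@le_trans _ _ (m%:R * v / m%:R ^+ 2 +
    \sum_(j < (2 * k.+1).+1) ((2 * k.+1)%:R * v / m%:R ^+ 2))).
  rewrite lerD2l; apply: ler_sum => j _.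
  by rewrite ler_wpM2r ?invr_ge0 ?sqr_ge0// ler_wpM2r// ler_nat -ltnS.
rewrite sumr_const card_ord m2 -(mulr_natr _ (2 * k.+1).+1) -(natr1 (2 * k.+1)) natrM.
have : 1 <= k.+1%:R :> R by rewrite ler1n.
move: (k.+1%:R) => x x1; have x0 : x != 0 by rewrite gt_eqF// (lt_le_trans _ x1).
rewrite -subr_ge0 (_ : _ - _ = 2 * v * (x - 1) / x ^+ 3); last first.
  by field; rewrite x0.
rewrite divr_ge0 ?exprn_ge0 ?mulr_ge0 ?subr_ge0//; exact: le_trans x1.
Qed.

Let psum_le_block k j w (n := (k.+1 ^ 2 + j)%N) : (j <= 2 * k.+1)%N ->
  (n%:R^-1 * psum Z 0 n w) ^+ 2 <= 2 * block k w.
Proof.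
move=> jk; set m := (k.+1 ^ 2)%N.
have m0 : 0 < m%:R :> R by rewrite ltr0n expn_gt0.
have mn : m%:R <= n%:R :> R by rewrite ler_nat leq_addr.
have n0 : 0 < n%:R :> R by exact: lt_le_trans mn.
set a := psum Z 0 m w / m%:R; set b := psum Z m n w / m%:R.
apply: (@le_trans _ _ ((a + b) ^+ 2)).
  rewrite (psum_split Z w (leq_addr j m)) -/n -mulrDl.
  rewrite mulrC !exprMn ler_wpM2l ?sqr_ge0// !exprVn.
  by rewrite lef_pV2 ?posrE ?exprn_gt0// ler_pXn2r// nnegrE ltW.
have sqrD_le (x y : R) : (x + y) ^+ 2 <= 2 * (x ^+ 2 + y ^+ 2).
  by have := sqr_ge0 (x - y); nra.
apply: (le_trans (sqrD_le a b)).
rewrite ler_pM2l// /block -/m -/a lerD2l.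
rewrite (bigD1 (Ordinal (jk : (j < (2 * k.+1).+1)%N)))//= -/n -/b lerDl.
by apply: sumr_ge0 => i _; exact: sqr_ge0.
Qed.

(** The variances of [psum 0 n / n] are not summable, but those of whole blocks
    between consecutive squares are, because a block of length [2 k + 3] adds
    little variance to its left end. *)
Theorem slln_psum : {ae P, forall w, n%:R^-1 * psum Z 0 n w @[n --> \oo] --> (0 : R)}.
Proof.
have := ae_cvg0_of_summable measurable_block block_ge0 integral_block
  (sum_inv_sqr_lty (mulr_ge0 (ler0n R 7) v0)).
apply: filterS => w /cvgrPdist_le Wk; apply/cvgrPdist_le => e e0.
have e20 : 0 < e ^+ 2 / 2 by rewrite divr_gt0// exprn_gt0.
have [N _ NP] := Wk _ e20.
exists (N.+1 ^ 2)%N => // n /= Nn.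
have exK : exists K, (K ^ 2 <= n)%N by exists N.+1.
have ubK K : (K ^ 2 <= n)%N -> (K <= n)%N.
  by apply: leq_trans; rewrite expnS expn1; case: K => // K; exact: leq_pmulr.
(* K is the integer part of the square root of n *)
case: (ex_maxnP exK ubK) => K Kn Kmax.
have NK : (N < K)%N by exact: Kmax.
case: K => // k in Kn Kmax NK *.
have := NP k NK; rewrite /= sub0r normrN ger0_norm// => bk.
have nlt : (n < k.+2 ^ 2)%N.
  by rewrite ltnNge; apply/negP => /Kmax; rewrite ltnn.
have nE : n = (k.+1 ^ 2 + (n - k.+1 ^ 2))%N by rewrite subnKC.
have jk : (n - k.+1 ^ 2 <= 2 * k.+1)%N.
  by rewrite leq_subLR -ltnS; move: nlt; rewrite -!mulnn; nia.
rewrite sub0r normrN -(ler_pXn2r (ltn0Sn 1)) ?nnegrE ?(ltW e0)//.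
rewrite real_normK ?num_real// nE.
apply: (le_trans (psum_le_block w jk)).
by rewrite -ler_pdivlMl// mulrC.
Qed.

End slln.


(** * The central limit theorem *)

Section clt.
Context {R : realType}.

Lemma cvg_inv_sqrt : (Num.sqrt n.+1%:R)^-1 @[n --> \oo] --> (0 : R).
Proof.
have E n : (Num.sqrt n.+1%:R)^-1 = Num.sqrt (@harmonic R n).
  by rewrite /harmonic sqrtrV.
under eq_fun do rewrite E.
have := cvg_comp _ _ (@cvg_harmonic R) (@sqrt_continuous R 0).
by rewrite sqrtr0.
Qed.

(** After scaling by [n], the quadratic bound of the remainder is an integrable
    majorant and the cubic one makes it vanish in the limit. *)
Lemma cvg_taylor_rest (mu : probability R R) v : centered_var mu v ->
  n.+1%:R * taylor_rest mu (Num.sqrt n.+1%:R)^-1 @[n --> \oo] --> (0 : R).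
Proof.
move=> cv; have [_ _ i2 _] := cv.
pose c n : R := (Num.sqrt n.+1%:R)^-1.
have c0 n : 0 < c n by rewrite invr_gt0 sqrtr_gt0 ltr0n.
have c2 n : n.+1%:R * c n ^+ 2 = 1.
  by rewrite exprVn sqr_sqrtr ?ler0n// divff.
pose f n z := n.+1%:R * Num.min ((c n * z) ^+ 2) (`|c n * z| ^+ 3).
have f0 n z : 0 <= f n z.
  by rewrite mulr_ge0// le_min sqr_ge0 exprn_ge0.
have fsqr n z : f n z <= z ^+ 2.
  rewrite -[leRHS]mul1r -(c2 n) -mulrA -exprMn ler_wpM2l//.
  by rewrite ge_min lexx.
have fcub n z : f n z <= `|z| ^+ 3 * c n.
  rewrite -[leRHS]mul1r -(c2 n) -mulrA ler_wpM2l// ge_min; apply/orP; right.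
  rewrite normrM (gtr0_norm (c0 n)) le_eqVlt; apply/orP; left; apply/eqP; ring.
have E n : n.+1%:R * taylor_rest mu (c n) = \int[mu]_z f n z.
  by rewrite /taylor_rest -RintegralZl//; exact: integrable_taylor_rest cv.
rewrite (_ : (fun _ => _) = (fun n => \int[mu]_z f n z)); last first.
  by apply/funext => n; exact: E.
have mf n : measurable_fun setT (f n).
  by apply: measurable_funM => //; exact: measurable_taylor_rest.
have lim : ((\int[mu]_z (f n z)%:E)%E @[n --> \oo] --> \int[mu]_z (cst 0 z))%E.
  apply: (@dominated_cvg _ _ _ mu setT measurableT (fun n z => (f n z)%:E) _
    (fun z => (z ^+ 2)%:E)) => //.
  - by move=> n; exact/measurable_EFinP.
  - move=> z _; apply/cvg_EFin; first exact: nearW.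
    apply: (@squeeze_cvgr _ _ _ _ (fun=> 0) (fun n => `|z| ^+ 3 * c n)).
    + by apply: nearW => n /=; rewrite f0 fcub.
    + exact: cvg_cst.
    + rewrite -[X in _ --> X](mulr0 (`|z| ^+ 3)).
      by apply: cvgM; [exact: cvg_cst|exact: cvg_inv_sqrt].
  - by move=> n z _; rewrite lee_fin ger0_norm.
by move: lim; rewrite integral0 => /fine_cvg.
Qed.

Context {d : measure_display} {T : measurableType d}.
Variable P : probability T R.
Variables (gen : nat -> set (set T)) (Z : nat -> T -> R) (mu : probability R R).
Variable v : R.
Hypothesis gen_measurable : forall n, gen n `<=` measurable.
Hypothesis Z_adapted : forall i n, (i < n)%N -> adapted (gen n) (Z i).
Hypothesis Z_indep : forall n, indep_with_law P (gen n) (Z n) mu.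
Hypothesis mu_var : centered_var mu v.
Hypothesis v_gt0 : 0 < v.

Let c n : R := (Num.sqrt n.+1%:R)^-1.

Let c_gt0 n : 0 < c n.
Proof. by rewrite invr_gt0 sqrtr_gt0 ltr0n. Qed.

Let c_sqr n : c n ^+ 2 = n.+1%:R^-1.
Proof. by rewrite exprVn sqr_sqrtr ?ler0n. Qed.

(** Lindeberg's exchange against the normal steps of standard deviation [s n],
    which add up exactly to the normal law of variance [v]. *)
Lemma cvg_taylor2_psum (K : R) g g1 g2 : 0 <= K -> taylor2 K g g1 g2 ->
  \int[P]_w g (c n * psum Z 0 n.+1 w) @[n --> \oo] -->
  \int[gaussian (Num.sqrt v)]_x g x.
Proof.
move=> K0 tg; have bg : bmeas g by case: tg.
pose s n := c n * Num.sqrt v.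
have sv0 : 0 < Num.sqrt v by rewrite sqrtr_gt0.
have s0 n : 0 < s n by rewrite mulr_gt0.
have limG n : \int[gaussian (Num.sqrt v)]_x g x =
    iter n.+1 (conv (gaussian (s n)) 1) g 0.
  apply: etrans (esym (iter_conv_normal n 0 (s0 n) bg)).
  have -> : Num.sqrt n.+1%:R * s n = Num.sqrt v.
    by rewrite /s mulrA mulfV ?mul1r// gt_eqF// sqrtr_gt0 ltr0n.
  by apply: eq_Rintegral => x _; rewrite add0r mul1r.
have bound n : `|\int[gaussian (Num.sqrt v)]_x g x -
    \int[P]_w g (c n * psum Z 0 n.+1 w)| <=
    K * (n.+1%:R * taylor_rest mu (c n) + 12 * expR (1 / 2) * Num.sqrt v ^+ 3 * c n).
  rewrite (limG n) (psum_iter_conv gen_measurable Z_adapted Z_indep _ _ bg).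
  rewrite distrC.
  have vv : c n ^+ 2 * v = 1 ^+ 2 * s n ^+ 2.
    by rewrite expr1n mul1r exprMn sqr_sqrtr ?ltW.
  have := lindeberg_exchange n.+1 0 K0 tg mu_var
    (gaussian_centered_var (lt0r_neq0 (s0 n))) vv.
  move/le_trans; apply; rewrite mulrCA ler_wpM2l// mulrDr lerD2l.
  apply: (le_trans (ler_wpM2l (ler0n R n.+1) (taylor_rest_gaussian (s0 n)))).
  rewrite /s exprMn (exprSr (c n) 2) c_sqr le_eqVlt; apply/orP; left; apply/eqP.
  have : n.+1%:R != 0 :> R by rewrite pnatr_eq0.
  by move: (n.+1%:R : R) (c n) => y y' y0; field.
have lim0 : K * (n.+1%:R * taylor_rest mu (c n) +
    12 * expR (1 / 2) * Num.sqrt v ^+ 3 * c n) @[n --> \oo] --> (0 : R).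
  rewrite -(mulr0 K); apply: cvgM; first exact: cvg_cst.
  rewrite -(addr0 0); apply: cvgD; first exact: cvg_taylor_rest mu_var.
  rewrite -(mulr0 (12 * expR (1 / 2) * Num.sqrt v ^+ 3)).
  by apply: cvgM; [exact: cvg_cst|exact: cvg_inv_sqrt].
apply/cvgrPdist_le => e e0; move/cvgrPdist_le/(_ e e0): lim0.
apply: filterS => n; rewrite sub0r normrN => h.
by rewrite (le_trans (bound n))// (le_trans _ h)// ler_norm.
Qed.

(** The steps are smooth test functions and the laws of the normalized sums all
    have second moment [v], so that [weak_cvg_of_steps] applies. *)
Theorem clt_psum (f : R -> R) : continuous f -> (exists C, bounded_by C f) ->
  \int[P]_w f ((Num.sqrt n%:R)^-1 * psum Z 0 n w) @[n --> \oo] -->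
  \int[gaussian (Num.sqrt v)]_x f x.
Proof.
move=> cf bf.
have mX n : measurable_fun setT (fun w => c n * psum Z 0 n.+1 w).
  by apply: measurable_funM => //; exact: measurable_psum gen_measurable Z_adapted _ _.
pose lam n : probability R R := distribution P (rv (mX n)).
have transfer n (g : R -> R) : measurable_fun setT g ->
    P.-integrable setT (fun w => (g (c n * psum Z 0 n.+1 w))%:E) ->
    \int[lam n]_x g x = \int[P]_w g (c n * psum Z 0 n.+1 w).
  move=> mg ig; congr fine.
  have mgE : measurable_fun setT (EFin \o g) by exact/measurable_EFinP.
  by rewrite (integral_distribution (X := rv (mX n)) mgE).
have bP n (g : R -> R) : bmeas g ->
    P.-integrable setT (fun w => (g (c n * psum Z 0 n.+1 w))%:E).
  move=> [mg [M gM]].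
  apply: (@bmeas_integrable _ _ _ P (fun w => g (c n * psum Z 0 n.+1 w))).
  by split; [exact: measurableT_comp (mX n)|exists M => w; exact: gM].
have mf : measurable_fun setT f by exact: continuous_measurable_fun.
suff : \int[lam n]_x f x @[n --> \oo] --> \int[gaussian (Num.sqrt v)]_x f x.
  move=> H; rewrite -cvg_shiftS.
  rewrite (_ : (fun _ => _) = (fun n => \int[lam n]_x f x))//.
  by apply/funext => n; rewrite transfer//; apply: bP.
have sv0 : Num.sqrt v != 0 by rewrite gt_eqF// sqrtr_gt0.
apply: (@weak_cvg_of_steps _ lam _ v) => //.
- move=> a b.
  have := taylor2_affine a b (ler0n R 152) (@taylor2_step R) => tg.
  have K0 : 0 <= 152 * (a ^+ 2 + `|a| ^+ 3) :> R.
    by rewrite mulr_ge0// addr_ge0 ?sqr_ge0 ?exprn_ge0.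
  have := cvg_taylor2_psum K0 tg.
  rewrite (_ : (fun _ => _) = (fun n => \int[lam n]_x step (a * x + b)))//.
  apply/funext => n; have bs := bmeas_step_affine a b.
  by rewrite transfer//; [case: bs|exact: (bP n _ bs)].
- move=> n.
  have [iS ES] := psum_sqr gen_measurable Z_adapted Z_indep mu_var 0 n.+1.
  rewrite add0n in iS ES.
  have iS2 : P.-integrable setT (fun w => ((c n * psum Z 0 n.+1 w) ^+ 2)%:E).
    under eq_fun do rewrite exprMn.
    exact: (integrableZl measurableT (c n ^+ 2) iS).
  have m2 : measurable_fun [set: R] (fun x : R => x ^+ 2) by [].
  have m2E : measurable_fun [set: R] (fun x : R => (x ^+ 2)%:E).
    exact/measurable_EFinP.
  split; first by apply: integrable_pushforward.
  rewrite (transfer n _ m2 iS2); under eq_Rintegral do rewrite exprMn.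
  by rewrite RintegralZl// ES c_sqr mulrA mulVf// mul1r.
- have [_ _ i2 E2] := gaussian_centered_var sv0; split => //.
  by rewrite E2 sqr_sqrtr// ltW.
Qed.

End clt.

(** * The past of the process *)

Section past.
Context {d : measure_display} {T : measurableType d} {R : realType}.
Variable P : probability T R.

(** The finite measures [A |-> P (A `&` E)] and [A |-> P A * P E] agree on a
    pi-system, hence on the sigma-algebra that it generates. *)
Lemma indep_sigma_of_pi (G : set (set T)) (E : set T) :
  G `<=` measurable -> setI_closed G -> G setT -> measurable E ->
  (forall A, G A -> P (A `&` E) = (P A * P E)%E) ->
  forall A, <<s G >> A -> P (A `&` E) = (P A * P E)%E.
Proof.
move=> Gm GI GT mE GE A sA.
have pE0 : 0 <= fine (P E) by rewrite fine_ge0.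
pose r : {nonneg R} := NngNum pE0.
pose m1 := mrestr P mE; pose m2 := mscale r P.
have rE : r%:num%:E = P E by rewrite /= fineK// fin_num_measure.
suff : m1 A = m2 A by rewrite /m1 /m2 /mrestr /mscale rE muleC.
apply: (@g_sigma_algebra_measure_unique _ _ _ G Gm (fun=> setT)) => //.
- by rewrite bigcup_const.
- by move=> B GB; rewrite /m1 /m2 /= /mrestr /mscale rE GE// muleC.
- move=> _; rewrite /= /mrestr setTI.
  by rewrite (le_lt_trans (probability_le1 P mE)) ?ltry.
Qed.

Variables (eta : nat -> {RV P >-> R}) (y0 : {RV P >-> R}).
Hypothesis eta_indep : independent_RVs [set t | (1 <= t)%N] eta.
Hypothesis y0_indep : independent_of_family y0 [set t | (1 <= t)%N] eta.

(** The initial value takes the place of the index 0. *)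
Definition cylinder n (A : nat -> set R) : set T :=
  [set w | A 0%N (y0 w) /\ forall i, (1 <= i <= n)%N -> A i (eta i w)].

Definition past n : set (set T) :=
  [set B | exists2 A : nat -> set R, (forall i, measurable (A i)) &
    B = cylinder n A].

Let J n : {fset nat} := [fset i in iota 1 n]%fset.

Let mem_J n i : (i \in J n) = (1 <= i <= n)%N.
Proof. by rewrite !inE mem_iota add1n ltnS. Qed.

Let cylinderE n A : cylinder n A =
  y0 @^-1` A 0%N `&` \bigcap_(i in [set` J n]) (eta i @^-1` A i).
Proof.
apply/seteqP; split => w /= [h0 h]; split => // i /=.
  by rewrite mem_J; exact: h.
by move=> hi; apply: h => /=; rewrite mem_J.
Qed.

Let sigma_bigcapJ n A : (forall i, measurable (A i)) ->
  sigma_RVs [set t | (1 <= t)%N] eta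
    (\bigcap_(i in [set` J n]) (eta i @^-1` A i)).
Proof.
move=> mA; rewrite /sigma_RVs; set G := \bigcup_(i in _) _.
apply: (@bigcap_measurableType _ (g_sigma_algebraType G)) => i /=.
rewrite mem_J => /andP[i1 _]; apply: sub_sigma_algebra; exists i => //.
by exists (A i) => //; rewrite setTI.
Qed.

Lemma past_measurable n : past n `<=` measurable.
Proof.
move=> _ [A mA ->]; rewrite cylinderE; apply: measurableI.
  exact: measurable_funPTI.
by apply: bigcap_measurableType => i _; exact: measurable_funPTI.
Qed.

Lemma past_setI n : setI_closed (past n).
Proof.
move=> _ _ [A mA ->] [B mB ->]; exists (fun i => A i `&` B i).
  by move=> i; exact: measurableI.
apply/seteqP; split => w /=.
  by move=> [[a0 a] [b0 b]]; split => // i hi; split; [exact: a|exact: b].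
by move=> [[a0 b0] h]; split; split => // i hi; case: (h i hi).
Qed.

Lemma past_setT n : past n setT.
Proof. by exists (fun=> setT) => //; apply/seteqP; split. Qed.

Let past_indep n (A : nat -> set R) (C : set R) :
  (forall i, measurable (A i)) -> measurable C ->
  P (cylinder n A `&` eta n.+1 @^-1` C) =
  (P (cylinder n A) * P (eta n.+1 @^-1` C))%E.
Proof.
move=> mA mC; rewrite !cylinderE; set D := \bigcap_(i in _) _.
set E := eta n.+1 @^-1` C.
pose A' i := if i == n.+1 then C else A i.
have mA' i : measurable (A' i) by rewrite /A'; case: eqP.
have JS : J n.+1 = (n.+1 |` J n)%fset.
  apply/fsetP => i; rewrite in_fset1U !mem_J [RHS]orbC.
  by apply/idP/idP; lia.
have nJ : n.+1 \notin J n by rewrite mem_J; lia.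
have A'E i : i \in J n -> A' i = A i.
  by rewrite /A'; case: eqP => // ->; rewrite (negbTE nJ).
have sub1 m : [set` J m] `<=` [set t | (1 <= t)%N].
  by move=> i /=; rewrite mem_J => /andP[].
have DE : \bigcap_(i in [set` J n]) (eta i @^-1` A' i) = D.
  by apply: eq_bigcapr => i /= iJ; rewrite A'E.
have DEE : \bigcap_(i in [set` J n.+1]) (eta i @^-1` A' i) = E `&` D.
  by rewrite JS bigcap_fsetU1 DE /A' eqxx.
have PDE : P (E `&` D) = (P E * P D)%E.
  rewrite -DEE -DE !eta_indep//.
  by rewrite JS big_fsetU1//= /A' eqxx.
have sD : sigma_RVs [set t | (1 <= t)%N] eta D.
  by rewrite -DE; exact: sigma_bigcapJ.
have sED : sigma_RVs [set t | (1 <= t)%N] eta (E `&` D).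
  by rewrite -DEE; exact: sigma_bigcapJ.
rewrite -setIA (setIC D) (y0_indep _ sED)// PDE (y0_indep _ sD)//.
by rewrite (muleC (P E)) muleA.
Qed.

(** [eta n.+1] is independent of the past: of the previous [eta i] by mutual
    independence, and of [y0] because [y0] is independent of all of them
    jointly. *)
Lemma past_indep_eta n (B : set T) (C : set R) : <<s past n >> B ->
  measurable C ->
  P (B `&` eta n.+1 @^-1` C) = (P B * P (eta n.+1 @^-1` C))%E.
Proof.
move=> sB mC; apply: (indep_sigma_of_pi (@past_measurable n) (@past_setI n)
  (past_setT n) _ _ sB); first exact: measurable_funPTI.
by move=> _ [A mA ->]; exact: past_indep.
Qed.

Lemma adapted_y0 n : adapted (past n) y0.
Proof.
move=> _ A mA; apply: sub_sigma_algebra.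
exists (fun i => if i == 0%N then A else setT) => [i|]; first by case: eqP.
rewrite setTI; apply/seteqP; split => w /=.
  by move=> Aw; split => // i /andP[+ _]; case: i.
by case.
Qed.

Lemma adapted_eta n t : (1 <= t <= n)%N -> adapted (past n) (eta t).
Proof.
move=> tn _ A mA; apply: sub_sigma_algebra.
exists (fun i => if i == t then A else setT) => [i|]; first by case: eqP.
rewrite setTI; apply/seteqP; split => w /=.
  move=> Aw; split; first by case: eqP tn => [<-|].
  by move=> i _; case: eqP => [->|].
by move=> [_ /(_ t tn)]; rewrite eqxx.
Qed.

End past.

(** * The autoregressive model *)

Section model.
Context {d : measure_display} {T : measurableType d} {R : realType}.
Variables (P : probability T R) (phi0 alpha0 gamma0 sigma2 : R).
Variables (eta y : nat -> {RV P >-> R}).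
Hypothesis halpha0 : 0 < alpha0.
Hypothesis heta_iid : iid [set t | (1 <= t)%N] eta.
Hypothesis heta_sym : forall t, (1 <= t)%N -> symmetric_RV (eta t).
Hypothesis hnz : forall t, (1 <= t)%N ->
  {ae P, forall w, phi0 + eta t w * Num.sqrt alpha0 != 0}.
Hypothesis hgamma0 : 'E_P[log_coef phi0 alpha0 (eta 1%N)]%E = gamma0%:E.
Hypothesis hsigma2 : 'V_P[log_coef phi0 alpha0 (eta 1%N)]%E = sigma2%:E.
Hypothesis hy0_nz : P [set w | y 0%N w = 0] = 0%E.
Hypothesis hy0_indep : independent_of_family (y 0%N) [set t | (1 <= t)%N] eta.
Hypothesis hy : forall t, (1 <= t)%N -> forall w,
  y t w = phi0 * y t.-1 w + eta t w * Num.sqrt (alpha0 * y t.-1 w ^+ 2).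

Definition centered_log (x : R) := ln `|phi0 + x * Num.sqrt alpha0| - gamma0.

Lemma measurable_centered_log : measurable_fun setT centered_log.
Proof.
apply: measurable_funB => //; apply: (measurableT_comp (@measurable_ln R)).
apply: measurableT_comp => //; apply: measurable_funD => //.
exact: measurable_funM.
Qed.

Definition signed_noise k w :=
  if 0 <= y k w then eta k.+1 w else - eta k.+1 w.

Definition innovation k w := centered_log (signed_noise k w).

Let gen k := past eta (y 0%N) k.

Let gen_measurable k : gen k `<=` measurable.
Proof. exact: past_measurable. Qed.

Lemma adapted_y n t : (t <= n)%N -> adapted (gen n) (y t).
Proof.
elim: t => [_|t IH tn]; first exact: adapted_y0.
have ay := IH (ltnW tn).
have ae : adapted (gen n) (eta t.+1) by apply: adapted_eta; rewrite tn.
rewrite /adapted (_ : (y t.+1 : T -> R) = (fun w => phi0 * y t w +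
   eta t.+1 w * Num.sqrt (alpha0 * y t w ^+ 2))); last first.
  by apply/funext => w; rewrite hy.
apply: measurable_funD; first exact: measurable_funM.
apply: measurable_funM => //; apply: measurableT_comp.
  by apply: continuous_measurable_fun; exact: sqrt_continuous.
by apply: measurable_funM => //; exact: measurable_funX.
Qed.

Lemma adapted_signed_noise k n : (k < n)%N -> adapted (gen n) (signed_noise k).
Proof.
move=> kn; have ay := adapted_y (ltnW kn).
have ae : adapted (gen n) (eta k.+1) by apply: adapted_eta; rewrite kn.
apply: measurable_fun_ifT => //; last exact: measurable_funN.
exact: measurable_fun_ler.
Qed.

(** The sign of the past does not alter a symmetric law, nor does it create
    dependence. *)
Lemma signed_noise_indep k (B : set T) (C : set R) : <<s gen k >> B ->
  measurable C ->
  P (B `&` signed_noise k @^-1` C) = (P B * P (eta 1%N @^-1` C))%E.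
Proof.
move=> sB mC; set Y := [set w | 0 <= y k w].
have sY : <<s gen k >> Y.
  have : @measurable _ (g_sigma_algebraType (gen k)) (setT `&` (y k @^-1` `[0, +oo[)).
    by apply: (adapted_y (leqnn k)) => //; exact: measurable_itv.
  rewrite setTI (_ : _ @^-1` _ = Y)//.
  by apply/seteqP; split => w; rewrite /Y /= in_itv/= andbT.
have sBY : <<s gen k >> (B `&` Y).
  exact: (@measurableI _ (g_sigma_algebraType (gen k))).
have sBY' : <<s gen k >> (B `&` ~` Y).
  apply: (@measurableI _ (g_sigma_algebraType (gen k))) => //.
  exact: (@measurableC _ (g_sigma_algebraType (gen k))).
have toT A : <<s gen k >> A -> measurable A.
  exact: (smallest_sub (@sigma_algebra_measurable _ T) (@gen_measurable k)).
pose C' := [set x | C (- x)].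
have mC' : measurable C'.
  rewrite (_ : C' = setT `&` (-%R @^-1` C)); last by rewrite setTI.
  exact: oppr_measurable.
have law_eta : P (eta k.+1 @^-1` C) = P (eta 1%N @^-1` C).
  by apply: heta_iid.2.
have law_opp : P (eta k.+1 @^-1` C') = P (eta 1%N @^-1` C).
  by rewrite -law_eta; exact/esym/heta_sym.
have -> : B `&` signed_noise k @^-1` C =
    ((B `&` Y) `&` eta k.+1 @^-1` C) `|` ((B `&` ~` Y) `&` eta k.+1 @^-1` C').
  apply/seteqP; split => w /=; rewrite /signed_noise /Y /C' /=.
    by case: ifPn => [y0 [Bw Cw]|/negP y0 [Bw Cw]]; [left|right].
  by move=> [[[Bw ->]]|[[Bw /negP/negbTE ->]]].
transitivity (P ((B `&` Y) `&` eta k.+1 @^-1` C) +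
    P ((B `&` ~` Y) `&` eta k.+1 @^-1` C'))%E.
  apply: measureU.
  - by apply: measurableI; [exact: toT|exact: measurable_funPTI].
  - by apply: measurableI; [exact: toT|exact: measurable_funPTI].
  - by rewrite -subset0 => w [[[_ Yw] _] [[_ nYw] _]].
rewrite !(past_indep_eta heta_iid.1 hy0_indep)// law_eta law_opp.
rewrite -ge0_muleDl//; congr (_ * _)%E.
transitivity (P ((B `&` Y) `|` (B `&` ~` Y))).
  apply/esym/measureU; [exact: toT|exact: toT|].
  by rewrite -subset0 => w [[_ Yw] [_ nYw]].
by rewrite -setIUr setUv setIT.
Qed.

Let measurable_innovation1 : measurable_fun setT (fun w => centered_log (eta 1%N w)).
Proof. exact: (measurableT_comp measurable_centered_log). Qed.

Definition innovation_law : probability R R :=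
  distribution P (rv measurable_innovation1).

Lemma innovation_indep k : indep_with_law P (gen k) (innovation k) innovation_law.
Proof.
move=> B C sB mC; apply: (@signed_noise_indep k B (centered_log @^-1` C)) => //.
by rewrite -[X in measurable X]setTI; exact: measurable_centered_log.
Qed.

Lemma adapted_innovation k n : (k < n)%N -> adapted (gen n) (innovation k).
Proof.
move=> kn; apply: (measurableT_comp measurable_centered_log).
exact: adapted_signed_noise.
Qed.

Lemma innovation_centered_var : centered_var innovation_law sigma2.
Proof.
pose L := log_coef phi0 alpha0 (eta 1%N).
have mL : measurable_fun setT (fun w => L w - gamma0) := measurable_innovation1.
have E2 : (\int[P]_w ((L w - gamma0) ^+ 2)%:E = sigma2%:E)%E.
  rewrite -hsigma2 /variance unlock hgamma0 unlock.
  by apply: eq_integral => w _; rewrite expr2.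
have I2 : P.-integrable setT (fun w => ((L w - gamma0) ^+ 2)%:E).
  apply/integrableP; split; first by apply/measurable_EFinP; exact: measurable_funX.
  under eq_integral => w _ do rewrite gee0_abs ?lee_fin ?sqr_ge0//.
  by rewrite E2 ltry.
have I1 : P.-integrable setT (fun w => (L w - gamma0)%:E).
  have Ic := finite_measure_integrable_cst P (1 : R) (@measurableT _ T).
  apply: (le_integrable measurableT _ _ (integrableD measurableT Ic I2)).
    exact/measurable_EFinP.
  move=> w _ /=; rewrite lee_fin [leRHS]ger0_norm ?addr_ge0 ?sqr_ge0//.
  move: (L w - gamma0) => x; have := sqr_ge0 (x - 1); have := sqr_ge0 (x + 1).
  by rewrite ler_norml => ? ?; apply/andP; split; nra.
have Ig := finite_measure_integrable_cst P gamma0 (@measurableT _ T).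
have E1 : \int[P]_w (L w - gamma0) = 0.
  have IL : P.-integrable setT (EFin \o L).
    have := integrableD measurableT I1 Ig; apply: eq_integrable => // w _ /=.
    by rewrite -EFinD subrK.
  rewrite RintegralB// Rintegral_prob_cst.
  have := hgamma0; rewrite unlock /Rintegral => ->.
  by rewrite subrr.
have m1 : measurable_fun [set: R] (fun x : R => x%:E) by exact/measurable_EFinP.
have m2 : measurable_fun [set: R] (fun x : R => (x ^+ 2)%:E).
  exact/measurable_EFinP.
split.
- exact: (integrable_pushforward measurable_innovation1 m1 I1).
- by rewrite -E1; congr fine; rewrite (integral_distribution (X := rv measurable_innovation1) m1 I1).
- exact: (integrable_pushforward measurable_innovation1 m2 I2).
- rewrite /Rintegral (integral_distribution (X := rv measurable_innovation1) m2 I2).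
  by rewrite (_ : \int[P]_x _ = sigma2%:E)%E.
Qed.

(** The recursion is multiplicative, up to the sign absorbed by the noise. *)
Lemma y_recursion k w :
  y k.+1 w = y k w * (phi0 + signed_noise k w * Num.sqrt alpha0).
Proof.
rewrite hy//= sqrtrM ?ltW// sqrtr_sqr /signed_noise.
have [y0|y0] := leP 0 (y k w); first by rewrite ger0_norm//; ring.
by rewrite ltr0_norm//; ring.
Qed.

(** By [y_recursion] a zero would come from [y 0] or from a factor that has the
    law of [phi0 + eta 1 * Num.sqrt alpha0], which is almost surely nonzero. *)
Lemma ae_y_neq0 : {ae P, forall w, forall k, y k w != 0}.
Proof.
have ae0 : {ae P, forall w, y 0%N w != 0}.
  exists [set w | y 0%N w = 0]; split => //.
    rewrite (_ : [set w | _] = y 0%N @^-1` [set 0])//; exact: measurable_funPTI.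
  by move=> w /= /negP; rewrite negbK => /eqP.
have aek : {ae P, forall w, forall k,
    phi0 + signed_noise k w * Num.sqrt alpha0 != 0}.
  apply: ae_foralln => k.
  pose C := [set x : R | phi0 + x * Num.sqrt alpha0 = 0].
  have mC : measurable C.
    have mg : measurable_fun setT (fun x : R => phi0 + x * Num.sqrt alpha0).
      by apply: measurable_funD => //; exact: measurable_funM.
    have := mg measurableT _ (measurable_set1 0); rewrite setTI.
    by rewrite (_ : _ @^-1` _ = C).
  exists (signed_noise k @^-1` C); split.
  - rewrite -[X in measurable X]setTI.
    apply: (adapted_measurable (@gen_measurable k.+1)) => //.
    exact: adapted_signed_noise.
  - have sT : <<s gen k >> setT by exact: (@measurableT _ (g_sigma_algebraType (gen k))).
    have E0 : P (signed_noise k @^-1` C) = 0%E.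
      have := signed_noise_indep sT mC; rewrite setTI probability_setT mul1e => ->.
      have [N [mN PN NC]] := hnz (leqnn 1).
      apply/eqP; rewrite eq_le measure_ge0 andbT -PN.
      apply: le_measure; rewrite ?inE//; first exact: measurable_funPTI.
      by move=> w /= Cw; apply: NC => /=; apply/negP; rewrite negbK; exact/eqP.
    exact: E0.
  - by move=> w /= /negP; rewrite negbK => /eqP.
apply: filterS2 ae0 aek => w y0 yk; elim=> // k IH.
by rewrite y_recursion mulf_neq0.
Qed.

(** Off a negligible set the logarithm turns the product into a sum, so that the
    estimator is the mean of the variables [gamma0 + innovation i]. *)
Lemma gamma_hat_psum : {ae P, forall w, forall n, (1 <= n)%N ->
  gamma_hat y n w = gamma0 + n%:R^-1 * psum innovation 0 n w}.
Proof.
apply: filterS ae_y_neq0 => w yn0.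
have sum n : ln `|y n w| - ln `|y 0%N w| = psum innovation 0 n w + n%:R * gamma0.
  elim: n => [|n IH]; first by rewrite psumnn mul0r addr0 subrr.
  have nz : phi0 + signed_noise n w * Num.sqrt alpha0 != 0.
    by have := yn0 n.+1; rewrite y_recursion mulf_eq0 negb_or => /andP[].
  rewrite psumSr// y_recursion normrM lnM ?posrE ?normr_gt0//.
  rewrite addrAC IH /innovation /centered_log -natr1; ring.
move=> n n1; rewrite /gamma_hat sum mulrDr mulrA mulVf ?mul1r 1?addrC//.
by rewrite pnatr_eq0 -lt0n.
Qed.

End model.

(** * The estimator *)

Theorem theorem3p1 (d : measure_display) (T : measurableType d) (R : realType)
  (P : probability T R) (phi0 alpha0 gamma0 sigma2 : R)
  (eta y : nat -> {RV P >-> R})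
  (halpha0 : 0 < alpha0)
  (heta_iid : iid [set t | (1 <= t)%N] eta)
  (heta_sym : forall t, (1 <= t)%N -> symmetric_RV (eta t))
  (hnz : forall t, (1 <= t)%N ->
     {ae P, forall w, phi0 + eta t w * Num.sqrt alpha0 != 0})
  (hgamma0 : forall t, (1 <= t)%N ->
     'E_P[log_coef phi0 alpha0 (eta t)]%E = gamma0%:E)
  (hsigma2 : forall t, (1 <= t)%N ->
     'V_P[log_coef phi0 alpha0 (eta t)]%E = sigma2%:E)
  (hsigma2_gt0 : 0 < sigma2)
  (hy0_sym : symmetric_RV (y 0%N))
  (hy0_nz : P [set w | y 0%N w = 0] = 0%E)
  (hy0_indep : independent_of_family (y 0%N) [set t | (1 <= t)%N] eta)
  (hy : forall t, (1 <= t)%N -> forall w,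
     y t w = phi0 * y t.-1 w + eta t w * Num.sqrt (alpha0 * y t.-1 w ^+ 2)) :
  [/\ (forall n, (1 <= n)%N -> 'E_P[gamma_hat y n]%E = gamma0%:E),
      {ae P, forall w, gamma_hat y n w @[n --> \oo] --> gamma0} &
      cvg_in_distribution P
        (fun n w => Num.sqrt n%:R * (gamma_hat y n w - gamma0))
        (normal_prob 0 (Num.sqrt sigma2))].
Proof.
pose gen := past eta (y 0%N).
pose Z := innovation phi0 alpha0 gamma0 eta y.
have gen_m n : gen n `<=` measurable by exact: past_measurable.
have Z_adapted i n : (i < n)%N -> adapted (gen n) (Z i).
  exact: adapted_innovation hy i n.
have Z_indep n : indep_with_law P (gen n) (Z n)
    (innovation_law phi0 alpha0 gamma0 eta).
  exact: innovation_indep heta_iid heta_sym hy0_indep hy n.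
have Z_var := innovation_centered_var (hgamma0 1%N isT) (hsigma2 1%N isT).
have rep := gamma_hat_psum gamma0 halpha0 heta_iid heta_sym hnz hy0_nz hy0_indep hy.
have mpsum n : measurable_fun setT (psum Z 0 n).
  exact: measurable_psum gen_m Z_adapted 0%N n.
have mgh n : measurable_fun setT (gamma_hat y n).
  have mln t : measurable_fun setT (fun w => ln `|y t w|).
    apply: (measurableT_comp (@measurable_ln R)).
    exact: measurableT_comp.
  by apply: measurable_funM => //; exact: measurable_funB.
split.
- move=> n n1; have [iS ES] := psum_mean gen_m Z_adapted Z_indep Z_var n.
  have I0 := finite_measure_integrable_cst P gamma0 (@measurableT _ T).
  have I1 := integrableZl measurableT n%:R^-1 iS.
  have I2 := integrableD measurableT I0 I1.
  rewrite unlock.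
  transitivity (\int[P]_w (gamma0 + n%:R^-1 * psum Z 0 n w)%:E)%E.
    apply: ae_eq_integral => //.
    - exact/measurable_EFinP.
    - exact: (measurable_int P I2).
    - by apply: filterS rep => w h _; rewrite h.
  rewrite -[LHS]fineK; last exact: (integrable_fin_num measurableT I2).
  have := RintegralD measurableT I0 I1; rewrite /Rintegral /= => ->.
  have := RintegralZl n%:R^-1 measurableT iS; rewrite ES mulr0 /Rintegral => ->.
  by rewrite addr0; have := Rintegral_prob_cst P gamma0; rewrite /Rintegral => ->.
- have := slln_psum gen_m Z_adapted Z_indep Z_var.
  apply: filterS2 rep => w h lim0.
  have lim1 : gamma0 + n%:R^-1 * psum Z 0 n w @[n --> \oo] --> gamma0.
    by rewrite -[X in _ --> X]addr0; apply: cvgD => //; exact: cvg_cst.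
  rewrite -cvg_shiftS in lim1; rewrite -cvg_shiftS.
  rewrite (_ : (fun n => gamma_hat y n.+1 w) =
    (fun n => gamma0 + n.+1%:R^-1 * psum Z 0 n.+1 w))//.
  by apply/funext => n; rewrite h.
- move=> f cf bf.
  have mf : measurable_fun setT f by exact: continuous_measurable_fun.
  have [M fM] := bf.
  have lim := clt_psum gen_m Z_adapted Z_indep Z_var hsigma2_gt0 cf bf.
  have bfP (X : T -> R) : measurable_fun setT X ->
      P.-integrable setT (fun w => (f (X w))%:E).
    move=> mX; apply: (@bmeas_integrable _ _ _ P (fun w => f (X w))).
    by split; [exact: measurableT_comp|exists M => w; exact: fM].
  have bf' : bmeas f by split.
  rewrite -integral_gaussian_bounded//.
  have -> : (\int[gaussian (Num.sqrt sigma2)]_x (f x)%:E =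
      (\int[gaussian (Num.sqrt sigma2)]_x f x)%:E)%E.
    rewrite /Rintegral fineK//; apply: (integrable_fin_num measurableT).
    exact: bmeas_integrable.
  rewrite (_ : (fun n : nat => _) =
      (fun n => (\int[P]_w f ((Num.sqrt n%:R)^-1 * psum Z 0 n w))%:E)).
    by apply/cvg_EFin; [exact: nearW|exact: lim].
  apply/funext => n; rewrite unlock.
  have mX : measurable_fun setT (fun w => (Num.sqrt n%:R)^-1 * psum Z 0 n w).
    exact: measurable_funM.
  rewrite /Rintegral fineK; last first.
    by apply: (integrable_fin_num measurableT); exact: bfP.
  apply: ae_eq_integral => //.
  - apply/measurable_EFinP; apply: (measurableT_comp mf).
    by apply: measurable_funM => //; exact: measurable_funB.
  - by apply/measurable_EFinP; exact: measurableT_comp.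
  - apply: filterS rep => w h _ /=; congr (f _)%:E.
    have [->|n0] := eqVneq n 0%N; first by rewrite sqrtr0 psumnn mulr0 mul0r.
    rewrite h ?lt0n// addrC addKr mulrA; congr (_ * _).
    have sn : Num.sqrt n%:R != 0 :> R by rewrite gt_eqF// sqrtr_gt0 ltr0n lt0n.
    by rewrite -[in X in _ / X](@sqr_sqrtr R n%:R)//; field.
Qed.
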